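(* Let $G=(V,\mathcal E,w)$ be an undirected, connected, weighted graph on $n$ nodes with Laplacian $L=\sum_{e\in\mathcal E}w(e)E_eE_e^T$ and largest Laplacian eigenvalue $\lambda_n$. Let $\tau\ge0$ with $\tau\lambda_n<\pi/2$. Consider the consensus network with sensor noise $$\dot x(t)=-L\,x(t-\tau)+L\,\xi(t),\qquad y=M_nx,$$ where $\xi$ is a vector of $n$ mutually independent zero-mean Gaussian white noises of unit intensity. Then for every link $e=\{i,j\}\in\mathcal E$ the sensitivity coefficient is $$\kappa_e=\frac12\,E_e^{T}\big(\tau L+\cos(\tau L)\big)\big(M_n-\sin(\tau L)\big)^{\dagger}E_e .$$
   Context: Notation: - $E_e=e_i-e_j\in\mathbb R^n$, for an arbitrary orientation. - $M_n=I_n-\frac1n\mathbf1\mathbf1^T$. - $X^\dagger$ is the Moore–Penrose pseudo-inverse. - $\cos(X)$ and $\sin(X)$ are the matrix power-series functions. The performance is $$\rho_{ss}(L;\tau)=\lim_{t\to\infty}\mathbb E[y^Ty]=\frac1{2\pi}\int_{-\infty}^\infty\mathrm{Tr}[G(j\omega)^HG(j\omega)]d\omega,\qquad G(s)=M_n(sI+e^{-\tau s}L)^{-1}L.$$ The sensitivity coefficient of link $e$ is $\kappa_e=\partial\rho_{ss}/\partial w(e)$. The input matrix $B=L$ also depends on the weights and is differentiated accordingly. *)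

(* Defs.v *)
From HB Require Import structures.
From mathcomp Require Import all_boot all_order all_algebra.
From mathcomp Require Import all_classical all_reals all_analysis.
From mathcomp Require Import complex.
Set Implicit Arguments. Unset Strict Implicit. Unset Printing Implicit Defensive.
Import Order.TTheory GRing.Theory Num.Theory.
Local Open Scope ring_scope.
Local Open Scope classical_set_scope.

Section ConsensusDefs.
Variable R : realType.
Variable n : nat.

Definition Evec (e : 'I_n * 'I_n) : 'cV[R]_n :=
  \col_k ((k == e.1)%:R - (k == e.2)%:R).

Definition Mn : 'M[R]_n := 1%:M - (n%:R)^-1 *: const_mx 1.

Definition lap (E : {set 'I_n * 'I_n}) (w : 'I_n * 'I_n -> R) : 'M[R]_n :=
  \sum_(e in E) w e *: (Evec e *m (Evec e)^T).

Definition upd (w : 'I_n * 'I_n -> R) (e : 'I_n * 'I_n) (t : R) :=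
  fun e' => if e' == e then t else w e'.

Definition adj (E : {set 'I_n * 'I_n}) : rel 'I_n :=
  fun i j => ((i, j) \in E) || ((j, i) \in E).
Definition connected_graph (E : {set 'I_n * 'I_n}) : Prop :=
  forall i j : 'I_n, connect (adj E) i j.

Definition largest_eig (A : 'M[R]_n) (lam : R) : Prop :=
  eigenvalue A lam /\ (forall a, eigenvalue A a -> a <= lam).

Definition mx_cos (X : 'M[R]_n) : 'M[R]_n :=
  \matrix_(i, j) lim ((fun N : nat => \sum_(k < N)
      (((-1) ^+ k / (k.*2)`!%:R) *: X ^+ k.*2) i j) @ \oo).
Definition mx_sin (X : 'M[R]_n) : 'M[R]_n :=
  \matrix_(i, j) lim ((fun N : nat => \sum_(k < N)
      (((-1) ^+ k / (k.*2.+1)`!%:R) *: X ^+ k.*2.+1) i j) @ \oo).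

Definition penrose (A X : 'M[R]_n) : Prop :=
  [/\ A *m X *m A = A, X *m A *m X = X, (A *m X)^T = A *m X & (X *m A)^T = X *m A].
Definition mp_pinv (A : 'M[R]_n) : 'M[R]_n := xget 0 [set X | penrose A X].

Definition mxC (A : 'M[R]_n) : 'M[R[i]]_n := map_mx (fun x => x%:C%C) A.
Definition mx_adj (A : 'M[R[i]]_n) : 'M[R[i]]_n := map_mx (@conjc R) A^T.

(* transfer function G(s) = M_n (s I + e^{-tau s} L)^{-1} L at s = j om,
   with e^{-j tau om} = cos(tau om) - j sin(tau om) *)
Definition Gjw (L : 'M[R]_n) (tau om : R) : 'M[R[i]]_n :=
  mxC Mn *m invmx ((0 +i* om)%C%:M + (cos (tau * om) -i* sin (tau * om))%C *: mxC L)
     *m mxC L.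

Definition h2_integrand (L : 'M[R]_n) (tau om : R) : R :=
  complex.Re (\tr (mx_adj (Gjw L tau om) *m Gjw L tau om)).

Definition rho_ss (L : 'M[R]_n) (tau : R) : R :=
  fine (\int[@lebesgue_measure R]_(om in [set: R]) (h2_integrand L tau om)%:E)
  / (2 * pi).

End ConsensusDefs.

(* Main.v *)
(** Diagonalising the Laplacian by a real orthogonal matrix turns the performance
    into a sum over its eigenvalues x of the scalar integrals of
    x^2 / |i w + x exp(- i tau w)|^2.  After rescaling, with F(s) = s + exp(- a s)
    and a = tau x < pi / 2, one has on the imaginary axis
      1 / |F|^2 = 2 Re (N / ((1 + s^2) F)),
      N(s) = (1/2 + c s) exp(- a s) - s/2 + c s^2,
    and for c = cos a / (2 (1 - sin a)) the zeros of 1 + s^2 at i and - i are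
    cancelled by N.  Since F has no zero in the closed right half-plane, Cauchy's
    theorem on large rectangles applied to N / ((1 + s^2) F) - c / (s + 1), which
    is O(1 / |s|^2), evaluates the integral to 2 pi c; hence the performance is
    Tr f(L) with f(x) = x cos (tau x) / (2 (1 - sin (tau x))).

    To differentiate Tr f(L), the Taylor bound
    |f(y) - f(x) - (y - x) f'(x)| <= C (y - x)^2 is lifted to traces as in Klein's
    inequality, so no perturbation theory of eigenvalues is needed.  Finally
    f'(x) = (cos (tau x) + tau x) / (2 (1 - sin (tau x))), and the pseudo-inverse of
    M_n - sin (tau L) is (I - sin (tau L))^-1 - 1 1^T / n. *)
Require Import Defs.
From HB Require Import structures.
From mathcomp Require Import all_boot all_order all_algebra.
From mathcomp Require Import all_classical all_reals all_analysis.
From mathcomp Require Import complex.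
From mathcomp Require Import ring lra measurable_realfun.
Set Implicit Arguments. Unset Strict Implicit. Unset Printing Implicit Defensive.
Import Order.TTheory GRing.Theory Num.Theory.
Import numFieldNormedType.Exports.
Local Open Scope ring_scope.
Local Open Scope classical_set_scope.

(** * Orthogonal diagonalisation and functional calculus *)

Lemma trmx_mul_rv_ge0 (R : realDomainType) n (v : 'rV[R]_n) : 0 <= (v *m v^T) 0 0.
Proof. by rewrite mxE sumr_ge0// => i _; rewrite mxE -expr2 sqr_ge0. Qed.

Lemma trmx_mul_rv_eq0 (R : realDomainType) n (v : 'rV[R]_n) :
  ((v *m v^T) 0 0 == 0) = (v == 0).
Proof.
apply/idP/idP => [|/eqP->]; last by rewrite mul0mx mxE.
rewrite mxE psumr_eq0; last by move=> i _; rewrite mxE -expr2 sqr_ge0.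
move=> /allP h; apply/eqP/rowP => i; have := h i (mem_index_enum i).
by rewrite /= !mxE mulf_eq0 orbb => /eqP.
Qed.

(** The complexification of [A] is Hermitian, so it has a real eigenvalue. The characteristic
    polynomial is unchanged by the field extension, hence this value also has a real eigenvector. *)
Lemma sym_real_eigenvector (R : rcfType) n (A : 'M[R]_n.+1) : A^T = A ->
  exists a (v : 'rV[R]_n.+1), v != 0 /\ v *m A = a *: v.
Proof.
move=> AT; pose AC : 'M[R[i]]_n.+1 := map_mx (real_complex R) A.
have hAC : AC \is hermsymmx.
  apply: realsym_hermsym.
    by apply/is_hermitianmxP; rewrite expr0 scale1r map_mx_id// /AC map_trmx AT.
  by apply/mxOverP => i j; rewrite mxE; apply/complex_realP; exists (A i j).
have := hermitian_spectral_diag_real hAC => /mxOverP/(_ 0 0)/complex_realP[a ha].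
have /orthomx_spectralP hsp := hermitian_normalmx hAC.
have : eigenvalue AC (real_complex R a).
  apply/eigenvalueP; exists (row 0 (spectralmx AC)).
    rewrite -ha -row_mul {2}hsp !mulmxA mulmxV ?spectral_unit// mul1mx.
    by apply/rowP => j; rewrite !mxE (bigD1 0)//= big1 ?addr0 ?mxE ?eqxx// => i /negPf i0;
       rewrite mxE eq_sym i0 mul0r.
  apply/negP => /eqP r0; have := spectral_unit AC; rewrite -row_free_unit.
  move=> /row_freeP[B hB]; have := congr1 (row 0) hB; rewrite row_mul r0 mul0mx.
  by move=> /rowP/(_ 0); rewrite !mxE /= => /esym/eqP; rewrite oner_eq0.
rewrite eigenvalue_root_char /AC -map_char_poly fmorph_root -eigenvalue_root_char.
by case/eigenvalueP => v hv v0; exists a, v.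
Qed.

(** [H] is the reflection in the hyperplane orthogonal to [v - e]; if [v = e] the identity
    serves. *)
Lemma householder (R : realFieldType) n (e v : 'rV[R]_n) :
  e *m e^T = 1%:M -> v *m v^T = 1%:M ->
  exists H : 'M[R]_n, [/\ H^T = H, H *m H = 1%:M & e *m H = v].
Proof.
move=> e1 v1; pose u := v - e; pose k := (u *m u^T) 0 0.
have [/eqP u0|u0] := boolP (u == 0).
  exists 1%:M; rewrite trmx1 !mulmx1; split => //.
  by apply/esym/eqP; rewrite -subr_eq0 -/u u0.
have k0 : k != 0 by rewrite trmx_mul_rv_eq0.
have ukE : u *m u^T = k%:M by rewrite [LHS]mx11_scalar.
exists (1%:M - (2 / k) *: (u^T *m u)); split.
- by rewrite linearB/= trmx1 linearZ/= trmx_mul trmxK.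
- rewrite mulmxBr mulmx1 mulmxBl mul1mx -scalemxAl -scalemxAr.
  rewrite mulmxA -(mulmxA u^T) ukE mul_mx_scalar scalerA -scalemxAl scalerA.
  rewrite -scalerBl -addrA -opprD -scalerDl.
  by rewrite (_ : 2 / k + _ = 0) ?scale0r ?subr0//; field.
rewrite mulmxBr mulmx1 -scalemxAr mulmxA.
pose c := (e *m v^T) 0 0.
have ev : e *m v^T = c%:M by rewrite [LHS]mx11_scalar.
have ve : v *m e^T = c%:M by rewrite -[LHS]trmxK trmx_mul trmxK ev tr_scalar_mx.
have kE : k = 2 - 2 * c.
  rewrite /k /u linearB/= mulmxBl !mulmxBr v1 e1 ev ve !mxE eqxx !mulr1n; ring.
rewrite (_ : e *m u^T = (- (k / 2))%:M); last first.
  by rewrite /u linearB/= mulmxBr ev e1 -raddfB/=; congr (_%:M); rewrite kE; field.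
rewrite mul_scalar_mx scalerA.
by rewrite (_ : _ * _ = -1) ?scaleN1r ?opprK ?/u ?subrKC//; field; rewrite k0.
Qed.

(** Induction on the dimension: conjugating by a reflection that sends the first basis vector to a
    unit eigenvector splits off a one-by-one block. *)
Lemma sym_orthogonal_diag (R : rcfType) n (A : 'M[R]_n) : A^T = A ->
  exists (Q : 'M[R]_n) (d : 'rV[R]_n),
    Q *m Q^T = 1%:M /\ A = Q^T *m diag_mx d *m Q.
Proof.
elim: n A => [|n IH] A AT.
  by exists 1%:M, 0; split; apply/matrixP => - [].
have [a [v0 [v00 v0A]]] := sym_real_eigenvector AT.
pose k := (v0 *m v0^T) 0 0.
have k0 : 0 < k by rewrite lt_def trmx_mul_rv_eq0 v00 trmx_mul_rv_ge0.
pose v := (Num.sqrt k)^-1 *: v0.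
have v1 : v *m v^T = 1%:M.
  rewrite /v linearZ/= -scalemxAl -scalemxAr scalerA.
  rewrite [v0 *m _]mx11_scalar -/k scale_scalar_mx -invfM -expr2 sqr_sqrtr ?ltW//.
  by rewrite mulVf// gt_eqF.
have vA : v *m A = a *: v by rewrite /v -scalemxAl v0A !scalerA mulrC.
pose e : 'rV[R]_(1 + n) := row_mx 1%:M 0.
have e1 : e *m e^T = 1%:M by rewrite /e tr_row_mx mul_row_col trmx0 mulmx0 addr0 trmx1 mulmx1.
have [H [HT HH eH]] := householder e1 v1.
pose B : 'M[R]_(1 + n) := H *m A *m H.
have BT : B^T = B by rewrite /B !trmx_mul HT AT mulmxA.
have eB : e *m B = a *: e.
  by rewrite /B !mulmxA eH vA -scalemxAl -eH -mulmxA HH mulmx1.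
have BE : B = block_mx a%:M 0 0 (drsubmx B).
  have : usubmx B = row_mx a%:M 0.
    have -> : usubmx B = e *m B.
      by rewrite -{2}[B]vsubmxK /e mul_row_col mul1mx mul0mx addr0.
    by rewrite eB /e scale_row_mx scaler0 scale_scalar_mx mulr1.
  move=> uB; have ul : ulsubmx B = a%:M by rewrite /ulsubmx uB row_mxKl.
  have ur : ursubmx B = 0 by rewrite /ursubmx uB row_mxKr.
  (* Symmetry of [B] transfers the vanishing of the upper right block. *)
  have dl : dlsubmx B = 0 by rewrite -BT -[dlsubmx _]trmxK trmx_dlsub trmxK ur trmx0.
  by rewrite -{1}[B]submxK ul ur dl.
have [|Q [d [QQ BQ]]] := IH (drsubmx B); first by rewrite trmx_drsub BT.
pose Q1 : 'M[R]_(1 + n) := block_mx 1%:M 0 0 Q.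
pose d1 : 'rV[R]_(1 + n) := row_mx a%:M d.
have Q1E : Q1 *m Q1^T = 1%:M.
  rewrite /Q1 tr_block_mx mulmx_block !trmx0 !mulmx0 !mul0mx !addr0 !add0r QQ.
  by rewrite trmx1 mulmx1 -scalar_mx_block.
have Q1B : B = Q1^T *m diag_mx d1 *m Q1.
  rewrite BE BQ diag_mx_row tr_block_mx !mulmx_block !trmx0 !mulmx0 !mul0mx.
  rewrite !addr0 !add0r !mul0mx trmx1 mul1mx mulmx1 ?addr0 ?add0r.
  by congr block_mx; apply/matrixP => i j; rewrite !ord1 !mxE.
exists (Q1 *m H), d1; split.
  by rewrite trmx_mul HT mulmxA -[_ *m H *m H]mulmxA HH mulmx1 Q1E.
have -> : A = H *m B *m H.
  by rewrite /B !mulmxA HH mul1mx -mulmxA HH mulmx1.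
by rewrite Q1B trmx_mul HT !mulmxA.
Qed.

Section functional_calculus.
Variables (R : comNzRingType) (n : nat).
Implicit Types (Q P : 'M[R]_n) (x y d : 'I_n -> R).

(** The rows of [Q] play the role of eigenvectors. The eigenvalues form a function, so that scalar
    functions act by composition. With a plain transpose over a commutative ring, the same calculus
    serves real matrices and their complexifications. *)
Definition fmx Q x : 'M[R]_n := Q^T *m diag_mx (\row_l x l) *m Q.

Lemma fmxE Q x i j : fmx Q x i j = \sum_l x l * (Q l i * Q l j).
Proof.
rewrite mxE; apply: eq_bigr => l _; rewrite mul_mx_diag !mxE.
by rewrite mulrCA mulrA.
Qed.

Lemma fmxD Q x y : fmx Q (fun l => x l + y l) = fmx Q x + fmx Q y.
Proof.
by apply/matrixP => i j; rewrite [RHS]mxE !fmxE -big_split; apply: eq_bigr => l _;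
   rewrite mulrDl.
Qed.

Lemma fmxZ Q (k : R) x : fmx Q (fun l => k * x l) = k *: fmx Q x.
Proof.
by apply/matrixP => i j; rewrite [RHS]mxE !fmxE mulr_sumr; apply: eq_bigr => l _;
   rewrite -mulrA.
Qed.

Lemma trmx_fmx Q x : (fmx Q x)^T = fmx Q x.
Proof. by rewrite /fmx !trmx_mul trmxK tr_diag_mx mulmxA. Qed.

Lemma fmxM Q x y : Q *m Q^T = 1%:M ->
  fmx Q x *m fmx Q y = fmx Q (fun l => x l * y l).
Proof.
move=> QQ; rewrite /fmx !mulmxA -[_ *m Q *m Q^T]mulmxA QQ mulmx1.
rewrite -(mulmxA Q^T) mulmx_diag; congr (_ *m diag_mx _ *m _).
by apply/rowP => l; rewrite !mxE.
Qed.

Lemma fmx1 Q : Q *m Q^T = 1%:M -> fmx Q (fun=> 1) = 1%:M.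
Proof.
move=> QQ; rewrite /fmx (_ : \row_l 1 = const_mx 1); last first.
  by apply/rowP => l; rewrite !mxE.
by rewrite diag_const_mx mulmx1; exact: mulmx1C.
Qed.

Lemma fmxX Q x k : Q *m Q^T = 1%:M -> fmx Q x ^+ k = fmx Q (fun l => x l ^+ k).
Proof.
move=> QQ; elim: k => [|k IH].
  rewrite expr0 (_ : (fun _ => _) = fun=> 1) ?fmx1//.
rewrite exprS IH [LHS]fmxM//; congr fmx.
by apply/funext => l; rewrite exprS.
Qed.

(** By cyclicity of the trace only the overlap matrix [Q *m P^T] of the two bases enters. *)
Lemma mxtrace_fmxM Q P x y :
  \tr (fmx Q x *m fmx P y) = \sum_l \sum_m x l * y m * (Q *m P^T) l m ^+ 2.
Proof.
rewrite /fmx -2!mulmxA mxtrace_mulC !mulmxA.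
rewrite -(mulmxA _ P) (_ : P *m Q^T = (Q *m P^T)^T); last first.
  by rewrite trmx_mul trmxK.
rewrite -(mulmxA (diag_mx _)); set T := Q *m P^T.
rewrite [X in \tr X](_ : _ =
  \matrix_(l, k) \sum_m x l * y m * (T l m * T k m)); last first.
  apply/matrixP => l k; rewrite !mxE; apply: eq_bigr => m _.
  by rewrite mul_mx_diag mul_diag_mx !mxE; ring.
by apply: eq_bigr => l _; rewrite mxE; apply: eq_bigr => m _; rewrite expr2.
Qed.

Lemma mxtrace_fmx Q x : Q *m Q^T = 1%:M -> \tr (fmx Q x) = \sum_l x l.
Proof.
move=> QQ; rewrite /fmx -mulmxA mxtrace_mulC -mulmxA QQ mulmx1 mxtrace_diag.
by apply: eq_bigr => l _; rewrite mxE.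
Qed.

End functional_calculus.

Lemma invmx_fmx (F : fieldType) n (Q : 'M[F]_n) (y : 'I_n -> F) :
  Q *m Q^T = 1%:M -> (forall l, y l != 0) ->
  invmx (fmx Q y) = fmx Q (fun l => (y l)^-1).
Proof.
move=> QQ y0; have yV : fmx Q y *m fmx Q (fun l => (y l)^-1) = 1%:M.
  rewrite fmxM// -(fmx1 QQ); congr fmx; apply/funext => l; exact: mulfV.
have [uy _] := mulmx1_unit yV.
by rewrite -[RHS](mulKmx uy) yV mulmx1.
Qed.

Section functional_calculus_real.
Variables (R : realType) (n : nat).
Implicit Types (Q P : 'M[R]_n) (x y d : 'I_n -> R).

(* Klein's trick: in the eigenbases of two symmetric matrices, with overlaps
   (Q *m P^T) l m, a scalar inequality passes to the traces. *)
Lemma trace_taylor Q P (a b : 'I_n -> R) (f f' : R -> R) C :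
  Q *m Q^T = 1%:M -> P *m P^T = 1%:M ->
  (forall l m, `|f (b m) - f (a l) - (b m - a l) * f' (a l)| <= C * (b m - a l) ^+ 2) ->
  `|\sum_m f (b m) - \sum_l f (a l)
     - \tr (fmx Q (f' \o a) *m (fmx P b - fmx Q a))|
  <= C * \tr ((fmx P b - fmx Q a) *m (fmx P b - fmx Q a)).
Proof.
move=> QQ PP fC; pose T := Q *m P^T.
(* Taking the identity as the second matrix shows that the squared overlaps sum to one along each
   row; [tr2] does the same for columns. Single sums thus become double sums with common nonnegative
   weights. *)
have tr1 x : \sum_l x l = \sum_l \sum_m x l * T l m ^+ 2.
  have := mxtrace_fmxM Q P x (fun=> 1); rewrite fmx1// mulmx1.
  rewrite mxtrace_fmx// => ->.
  by apply: eq_bigr => l _; apply: eq_bigr => m _; rewrite mulr1.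
have tr2 y : \sum_m y m = \sum_l \sum_m y m * T l m ^+ 2.
  have := mxtrace_fmxM Q P (fun=> 1) y; rewrite fmx1// mul1mx.
  rewrite mxtrace_fmx// => ->.
  by apply: eq_bigr => l _; apply: eq_bigr => m _; rewrite mul1r.
have -> : \tr ((fmx P b - fmx Q a) *m (fmx P b - fmx Q a)) =
    \sum_l \sum_m (b m - a l) ^+ 2 * T l m ^+ 2.
  rewrite mulmxBr !mulmxBl !raddfB/= !fmxM// [\tr (fmx P b *m _)]mxtrace_mulC.
  rewrite mxtrace_fmxM !mxtrace_fmx// (tr1 (fun l => a l * a l)) (tr2 (fun m => b m * b m)).
  rewrite opprK -sumrN -!big_split/=; apply: eq_bigr => l _.
  rewrite -sumrN -!big_split/=; apply: eq_bigr => m _; rewrite -/T; ring.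
have -> : \sum_m f (b m) - \sum_l f (a l)
     - \tr (fmx Q (f' \o a) *m (fmx P b - fmx Q a)) =
    \sum_l \sum_m (f (b m) - f (a l) - (b m - a l) * f' (a l)) * T l m ^+ 2.
  rewrite mulmxBr raddfB/= fmxM// mxtrace_fmxM mxtrace_fmx//.
  rewrite (tr2 (fun m => f (b m))) (tr1 (fun l => f (a l))).
  rewrite (tr1 (fun l => (f' \o a) l * a l)) -!sumrB; apply: eq_bigr => l _.
  rewrite -!sumrB; apply: eq_bigr => m _; rewrite -/T /=; ring.
rewrite mulr_sumr (le_trans (ler_norm_sum _ _ _))//; apply: ler_sum => l _.
rewrite mulr_sumr (le_trans (ler_norm_sum _ _ _))//; apply: ler_sum => m _.
rewrite normrM [`|T l m ^+ 2|]ger0_norm ?sqr_ge0// mulrA.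
by rewrite ler_wpM2r ?sqr_ge0.
Qed.

(** Each entry of a partial sum is a fixed linear combination of the scalar partial sums at the
    eigenvalues. *)
Lemma mx_cos_fmx Q x : Q *m Q^T = 1%:M -> mx_cos (fmx Q x) = fmx Q (cos \o x).
Proof.
move=> QQ; apply/matrixP => i j; rewrite mxE fmxE; apply/cvg_lim => //.
rewrite (_ : (fun N => _) = fun N =>
    \sum_l series (cos_coeff' (x l)) N * (Q l i * Q l j)); last first.
  apply/funext => N; under [RHS]eq_bigr do rewrite /series /= big_mkord mulr_suml.
  rewrite exchange_big /=; apply: eq_bigr => k _.
  rewrite mxE fmxX// fmxE mulr_sumr; apply: eq_bigr => l _.
  by rewrite /cos_coeff' -exprnP; ring.
apply: cvg_big => [|l _]; first exact: add_continuous.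
by apply: cvgM; [exact: cvg_cos_coeff'|exact: cvg_cst].
Qed.

Lemma mx_sin_fmx Q x : Q *m Q^T = 1%:M -> mx_sin (fmx Q x) = fmx Q (sin \o x).
Proof.
move=> QQ; apply/matrixP => i j; rewrite mxE fmxE; apply/cvg_lim => //.
rewrite (_ : (fun N => _) = fun N =>
    \sum_l series (sin_coeff' (x l)) N * (Q l i * Q l j)); last first.
  apply/funext => N; under [RHS]eq_bigr do rewrite /series /= big_mkord mulr_suml.
  rewrite exchange_big /=; apply: eq_bigr => k _.
  rewrite mxE fmxX// fmxE mulr_sumr; apply: eq_bigr => l _.
  by rewrite /sin_coeff' -exprnP; ring.
apply: cvg_big => [|l _]; first exact: add_continuous.
by apply: cvgM; [exact: cvg_sin_coeff'|exact: cvg_cst].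
Qed.

End functional_calculus_real.

(** * Complex functions through their real and imaginary parts *)

Section complex_calculus.
Variable R : realType.
Implicit Types (z s : R[i]) (t x y : R).
Notation Re := complex.Re.
Notation Im := complex.Im.
Import Normc.

Lemma ReM z s : Re (z * s) = Re z * Re s - Im z * Im s.
Proof. by case: z s => [a b] [c d]. Qed.

Lemma ImM z s : Im (z * s) = Re z * Im s + Im z * Re s.
Proof. by case: z s => [a b] [c d]. Qed.

Lemma ReD z s : Re (z + s) = Re z + Re s.
Proof. by case: z s => [a b] [c d]. Qed.

Lemma ImD z s : Im (z + s) = Im z + Im s.
Proof. by case: z s => [a b] [c d]. Qed.

Lemma ReV z : Re z^-1 = Re z / (Re z ^+ 2 + Im z ^+ 2).
Proof. by case: z. Qed.

Lemma ImV z : Im z^-1 = - (Im z / (Re z ^+ 2 + Im z ^+ 2)).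
Proof. by case: z. Qed.

Lemma ReJM z : Re (conjc z * z) = Re z ^+ 2 + Im z ^+ 2.
Proof. by case: z => u v /=; ring. Qed.

Lemma normcD_le z s : normc (z + s) <= normc z + normc s.
Proof. exact: le_normcD. Qed.

Lemma normc_opp z : normc (- z) = normc z.
Proof. exact: normcN. Qed.

Lemma normc_ge0 z : 0 <= normc z.
Proof. by case: z => a b; rewrite /normc sqrtr_ge0. Qed.

Lemma Re_normc z : `|Re z| <= normc z.
Proof.
case: z => a b /=; rewrite -sqrtr_sqr ler_wsqrtr// lerDl sqr_ge0//.
Qed.

Lemma Im_normc z : `|Im z| <= normc z.
Proof.
case: z => a b /=; rewrite -sqrtr_sqr ler_wsqrtr// lerDr sqr_ge0//.
Qed.

Lemma normc_real (r : R) : normc (r%:C)%C = `|r|.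
Proof. by rewrite /= expr0n addr0 sqrtr_sqr. Qed.

Lemma normc_imag (r : R) : normc (0 +i* r)%C = `|r|.
Proof. by rewrite /= expr0n add0r sqrtr_sqr. Qed.

Lemma normc_ReIm z : normc z <= `|Re z| + `|Im z|.
Proof.
case: z => a b; rewrite -normc_real -normc_imag (le_trans _ (normcD_le _ _))//=.
by rewrite addr0 add0r.
Qed.

Lemma normc_neq0 z : 0 < normc z -> z != 0.
Proof. by apply: contraTneq => ->; rewrite normc0 ltxx. Qed.

Lemma complex_sqnorm_neq0 z : z != 0 -> Re z ^+ 2 + Im z ^+ 2 != 0.
Proof.
by case: z => a b; rewrite eq_complex /= paddr_eq0 ?sqr_ge0// !sqrf_eq0.
Qed.

(** Complex-valued functions of a real variable are differentiated componentwise, which keeps the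
    argument within real calculus. *)
Definition cderiv (h : R -> R[i]) t (d : R[i]) :=
  is_derive t 1 (fun x => Re (h x)) (Re d) /\
  is_derive t 1 (fun x => Im (h x)) (Im d).

Lemma cderiv_cst c t : cderiv (fun=> c) t 0.
Proof. by split; exact: is_derive_cst. Qed.

Lemma cderivD h k t d e : cderiv h t d -> cderiv k t e ->
  cderiv (fun x => h x + k x) t (d + e).
Proof.
move=> [hr hi] [kr ki]; split.
- under eq_fun do rewrite ReD; rewrite ReD; exact: is_deriveD.
- under eq_fun do rewrite ImD; rewrite ImD; exact: is_deriveD.
Qed.

Lemma cderivM h k t d e : cderiv h t d -> cderiv k t e ->
  cderiv (fun x => h x * k x) t (h t * e + d * k t).
Proof.
move=> [hr hi] [kr ki]; split.
- under eq_fun do rewrite ReM.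
  apply: (@is_derive_eq _ _ _ _ _ _ _ _ (is_deriveB (is_deriveM hr kr) (is_deriveM hi ki))).
  by rewrite ReD !ReM /GRing.scale/=; ring.
- under eq_fun do rewrite ImM.
  apply: (@is_derive_eq _ _ _ _ _ _ _ _ (is_deriveD (is_deriveM hr ki) (is_deriveM hi kr))).
  by rewrite ImD !ImM /GRing.scale/=; ring.
Qed.

Lemma cderivV h t d : h t != 0 -> cderiv h t d ->
  cderiv (fun x => (h x)^-1) t (- d * ((h t)^-1 * (h t)^-1)).
Proof.
move=> ht0 [hr hi]; have n0 := complex_sqnorm_neq0 ht0.
have dN : is_derive t 1 (fun x => Re (h x) * Re (h x) + Im (h x) * Im (h x))
    (2 * (Re (h t) * Re d + Im (h t) * Im d)).
  apply: (@is_derive_eq _ _ _ _ _ _ _ _ (is_deriveD (is_deriveM hr hr) (is_deriveM hi hi))).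
  by rewrite /GRing.scale/=; ring.
have n0' : Re (h t) * Re (h t) + Im (h t) * Im (h t) != 0 by rewrite -!expr2.
have dV := @is_deriveV R (fun x => Re (h x) * Re (h x) + Im (h x) * Im (h x)) _ _ _ n0' dN.
split.
- under eq_fun do rewrite ReV !expr2.
  apply: (@is_derive_eq _ _ _ _ _ _ _ _ (is_deriveM hr dV)).
  by rewrite !(ReM, ImM, ReV, ImV) /GRing.scale/= -?expr2; field.
- under eq_fun do rewrite ImV !expr2.
  apply: (@is_derive_eq _ _ _ _ _ _ _ _ (is_deriveN (is_deriveM hi dV))).
  by rewrite !(ReM, ImM, ReV, ImV) /GRing.scale/= -?expr2; field.
Qed.

(** This is exp(a z) for real [a], written with Euler's formula. *)
Definition cexp (a : R) z : R[i] :=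
  ((expR (a * Re z))%:C * (cos (a * Im z) +i* sin (a * Im z)))%C.

Lemma normc_cexp a z : normc (cexp a z) = expR (a * Re z).
Proof.
rewrite /cexp normcM normc_real /= cos2Dsin2 sqrtr1 mulr1.
by rewrite ger0_norm ?expR_ge0.
Qed.

Lemma cderiv_cexp a (h : R -> R[i]) t d : cderiv h t d ->
  cderiv (fun x => cexp a (h x)) t (a%:C%C * cexp a (h t) * d).
Proof.
move=> [hr hi].
have ar : is_derive t 1 (fun x => a * Re (h x)) (a * Re d) by exact: is_deriveZ.
have ai : is_derive t 1 (fun x => a * Im (h x)) (a * Im d) by exact: is_deriveZ.
have e1 : is_derive t 1 (fun x => expR (a * Re (h x)))
    (expR (a * Re (h t)) * (a * Re d)).
  exact: (@is_derive1_comp R expR _ t _ _ (is_derive_expR _) ar).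
have e2 : is_derive t 1 (fun x => cos (a * Im (h x)))
    (- sin (a * Im (h t)) * (a * Im d)).
  exact: (@is_derive1_comp R (@cos R) _ t _ _ (is_derive_cos _) ai).
have e3 : is_derive t 1 (fun x => sin (a * Im (h x)))
    (cos (a * Im (h t)) * (a * Im d)).
  exact: (@is_derive1_comp R (@sin R) _ t _ _ (is_derive_sin _) ai).
have : cderiv (fun x => (expR (a * Re (h x)))%:C%C) t
    ((expR (a * Re (h t)) * (a * Re d))%:C)%C.
  by split => //=; exact: is_derive_cst.
have : cderiv (fun x => (cos (a * Im (h x)) +i* sin (a * Im (h x)))%C) t
   ((- sin (a * Im (h t)) * (a * Im d)) +i* (cos (a * Im (h t)) * (a * Im d)))%C.
  by split.
move=> /[swap] /cderivM /[apply]; rewrite /cexp.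
set w := (X in cderiv _ _ X -> _); set w' := (X in _ -> cderiv _ _ X).
suff -> : w = w' by [].
by rewrite /w /w'; case: d {hr hi ar ai e1 e2 e3 w w'} => d1 d2;
   apply/eqP; rewrite eq_complex /=; apply/andP; split; apply/eqP; ring.
Qed.

(** Complex differentiability is stated as a chain rule along every differentiable curve through
    [z]; horizontal and vertical lines then yield the Cauchy-Riemann equations. *)
Definition holo (f : R[i] -> R[i]) z (d : R[i]) :=
  forall h t h', h t = z -> cderiv h t h' -> cderiv (f \o h) t (d * h').

(* Elementary functions whose reciprocals stay away from zero on the region S;
   this class is stable under complex differentiation. *)
Inductive elem (S : R[i] -> Prop) : (R[i] -> R[i]) -> Prop :=
| elem_cst c : elem S (fun=> c)
| elem_id : elem S (fun z => z)
| elem_exp a : elem S (cexp a)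
| elemD f g : elem S f -> elem S g -> elem S (fun z => f z + g z)
| elemM f g : elem S f -> elem S g -> elem S (fun z => f z * g z)
| elemV f e : elem S f -> 0 < e -> (forall z, S z -> e <= normc (f z)) ->
    elem S (fun z => (f z)^-1).

(** The derivative is built symbolically and stays in the class, so it can be bounded and
    differentiated again. A reciprocal reuses its own lower bound. *)
Lemma elem_holo S f : elem S f ->
  exists f', elem S f' /\ forall z, S z -> holo f z (f' z).
Proof.
elim=> [c||a|f1 f2 e1 [f1' [e1' h1]] e2 [f2' [e2' h2]]
  |f1 f2 e1 [f1' [e1' h1]] e2 [f2' [e2' h2]]|f1 e e1 [f1' [e1' h1]] e0 fe].
- exists (fun=> 0); split; first exact: elem_cst.
  by move=> z _ h t h' _ _; rewrite mul0r; exact: cderiv_cst.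
- exists (fun=> 1); split; first exact: elem_cst.
  by move=> z _ h t h' _ hh; rewrite mul1r.
- exists (fun z => a%:C%C * cexp a z); split.
    by apply: elemM; [exact: elem_cst|exact: elem_exp].
  by move=> z _ h t h' <- hh; exact: cderiv_cexp.
- exists (fun z => f1' z + f2' z); split; first exact: elemD.
  move=> z Sz h t h' hz hh; rewrite mulrDl.
  by apply: cderivD; [exact: h1|exact: h2].
- exists (fun z => f1 z * f2' z + f1' z * f2 z); split.
    by apply: elemD; exact: elemM.
  move=> z Sz h t h' hz hh; have := cderivM (h1 _ Sz _ _ _ hz hh) (h2 _ Sz _ _ _ hz hh).
  by rewrite /= hz (_ : _ + _ = (f1 z * f2' z + f1' z * f2 z) * h')//; ring.
- exists (fun z => -1 * f1' z * ((f1 z)^-1 * (f1 z)^-1)); split.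
    apply: elemM; first by apply: elemM => //; exact: elem_cst.
    by apply: elemM; apply: elemV e0 fe.
  move=> z Sz h t h' hz hh.
  have f10 : (f1 \o h) t != 0.
    by rewrite /= hz; apply: normc_neq0; rewrite (lt_le_trans e0)// fe.
  have := cderivV f10 (h1 _ Sz _ _ _ hz hh).
  by rewrite /= hz (_ : - (f1' z * h') * _ = -1 * f1' z * ((f1 z)^-1 * (f1 z)^-1) * h')//; ring.
Qed.

(** Supplies the constant that dominates the derivative when differentiating under the integral
    sign. *)
Lemma elem_bounded S f : (exists M, forall z, S z -> normc z <= M) ->
  elem S f -> exists M, forall z, S z -> normc (f z) <= M.
Proof.
move=> [M SM]; elim=> [c||a|f1 f2 e1 [M1 h1] e2 [M2 h2]
  |f1 f2 e1 [M1 h1] e2 [M2 h2]|f1 e e1 [M1 h1] e0 fe].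
- by exists (normc c).
- by exists M.
- exists (expR (`|a| * M)) => z Sz; rewrite normc_cexp ler_expR.
  rewrite (le_trans (ler_norm _))// normrM ler_wpM2l//.
  by rewrite (le_trans (Re_normc _))// SM.
- exists (M1 + M2) => z Sz; rewrite (le_trans (normcD_le _ _))//.
  by rewrite lerD ?h1 ?h2.
- exists (M1 * M2) => z Sz; rewrite normcM.
  by rewrite ler_pM ?normc_ge0 ?h1 ?h2.
- exists e^-1 => z Sz; rewrite normcV lef_pV2 ?posrE// ?fe//.
  by rewrite (lt_le_trans e0)// fe.
Qed.

End complex_calculus.

(** * Cauchy's theorem on rectangles, by differentiation under the integral sign *)

Section rectangle.
Variable R : realType.
Implicit Types (z s : R[i]) (t x y : R).
Notation Re := complex.Re.
Notation Im := complex.Im.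
Notation mu := (@lebesgue_measure R).
Import Normc.

Lemma is_derive_continuous (f : R -> R) x d :
  is_derive x 1 f d -> {for x, continuous f}.
Proof.
by move=> [df _]; apply: differentiable_continuous; exact/derivable1_diffP.
Qed.

Lemma cderiv_line_x y x : cderiv (fun t => (t +i* y)%C) x 1.
Proof. by split => /=; [exact: is_derive_id|exact: is_derive_cst]. Qed.

Lemma cderiv_line_y x y : cderiv (fun t => (x +i* t)%C) y (0 +i* 1)%C.
Proof. by split => /=; [exact: is_derive_cst|exact: is_derive_id]. Qed.

(** These are the Cauchy-Riemann equations: along the horizontal and the vertical line through a
    point, [f] has derivatives [f'] and i [f']. *)
Lemma elem_partial (S : R[i] -> Prop) f : elem S f ->
  exists2 f', elem S f' & forall x y, S (x +i* y)%C ->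
  [/\ is_derive x 1 (fun t => Re (f (t +i* y)%C)) (Re (f' (x +i* y)%C)),
      is_derive y 1 (fun t => Im (f (x +i* t)%C)) (Re (f' (x +i* y)%C)),
      is_derive y 1 (fun t => Re (f (x +i* t)%C)) (- Im (f' (x +i* y)%C)) &
      is_derive x 1 (fun t => Im (f (t +i* y)%C)) (Im (f' (x +i* y)%C))].
Proof.
move=> /elem_holo[f' [ef' hf]]; exists f' => // x y Sxy.
have [h1 h1'] := hf _ Sxy _ _ _ erefl (cderiv_line_x y x).
have [h2 h2'] := hf _ Sxy _ _ _ erefl (cderiv_line_y x y).
rewrite mulr1 in h1 h1'; rewrite !(ReM, ImM)/= !(mulr0, mulr1, addr0, add0r) in h2 h2'.
by [].
Qed.

(** Open in the real direction, in which one differentiates, and closed in the imaginary direction,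
    in which one integrates. *)
Definition strip x0 x1 W z := [/\ x0 < Re z, Re z < x1, 0 <= Im z & Im z <= W].

Lemma strip_bounded x0 x1 W : exists M, forall z, strip x0 x1 W z -> normc z <= M.
Proof.
exists (`|x0| + `|x1| + W) => z [h1 h2 h3 h4].
rewrite (le_trans (normc_ReIm z))// lerD//; last by rewrite ger0_norm.
have := ler_norm x1; have := ler_norm (- x0); rewrite normrN.
have := normr_ge0 x0; have := normr_ge0 x1; move: h1 h2.
by rewrite ler_norml => *; apply/andP; split; lra.
Qed.

Lemma continuous_integrable_itv (f : R -> R) a b :
  (forall y, a <= y <= b -> {for y, continuous f}) ->
  mu.-integrable `[a, b] (EFin \o f).
Proof.
move=> cf; apply: continuous_compact_integrable; first exact: segment_compact.
by apply: continuous_in_subspaceT => y; rewrite inE/= in_itv/=; exact: cf.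
Qed.

(* One side of Cauchy's theorem on a rectangle resting on the real axis. *)
Lemma elem_strip_derive x0 x1 W f x : 0 < W -> elem (strip x0 x1 W) f ->
  x0 < x -> x < x1 ->
  is_derive x 1 (fun x => \int[mu]_(y in `[0, W]) Re (f (x +i* y)%C))
    (Im (f (x +i* W)%C) - Im (f (x +i* 0)%C)).
Proof.
move=> W0 ef x0x xx1; have [f' ef' df] := elem_partial ef.
have [M fM] := elem_bounded (strip_bounded x0 x1 W) ef'.
have mW : measurable (`[0, W] : set R) by exact: measurable_itv.
have Sxy t y : `]x0, x1[%classic t -> `[0, W]%classic y -> strip x0 x1 W (t +i* y)%C.
  by rewrite /= !in_itv/= => /andP[? ?] /andP[? ?]; split.
have Ix : `]x0, x1[%classic x by rewrite /= in_itv/= x0x xx1.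
have intf t : `]x0, x1[%classic t ->
    mu.-integrable `[0, W] (EFin \o (fun y => Re (f (t +i* y)%C))).
  move=> It; apply: continuous_integrable_itv => y yW.
  have [] := df _ _ (Sxy t y It _); first by rewrite /= in_itv.
  by move=> _ _ /is_derive_continuous.
pose F t y := Re (f (t +i* y)%C).
have d1E t y : `]x0, x1[%classic t -> `[0, W]%classic y ->
    partial1of2 F t y = Re (f' (t +i* y)%C).
  move=> It Iy; rewrite partial1of2E.
  by have [[_ ->]] := df _ _ (Sxy _ _ It Iy).
have derF t y : `]x0, x1[%classic t -> `[0, W]%classic y -> derivable (F ^~ y) t 1.
  by move=> It Iy; have [[]] := df _ _ (Sxy _ _ It Iy).
have M0 : 0 <= M.
  rewrite (le_trans _ (fM _ (Sxy x 0 Ix _))) ?normc_ge0//.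
  by rewrite /= in_itv/= lexx ltW.
have intM : mu.-integrable `[0, W] (EFin \o (fun=> M)).
  by apply: continuous_integrable_itv => y _; exact: cst_continuous.
have dM t y : `]x0, x1[%classic t -> `[0, W]%classic y -> `|partial1of2 F t y| <= M.
  move=> It Iy; rewrite d1E// (le_trans (Re_normc _))// fM//; exact: Sxy.
apply: DeriveDef.
  exact: (@derivable_under_integral _ _ _ mu F _ mW x x0 x1 Ix intf derF _ (fun=> M0) intM dM).
rewrite -derive1E (@differentiation_under_integral _ _ _ mu F _ mW x x0 x1 Ix intf derF _ (fun=> M0) intM dM).
transitivity (\int[mu]_(y in `[0, W]) Re (f' (x +i* y)%C)).
  by apply: eq_Rintegral => y; rewrite inE => Iy; rewrite d1E.
(* The second derivative serves only to make [f'] continuous along the vertical segment. *)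
have [f'' _ df'] := elem_partial ef'.
(* By Cauchy-Riemann the integrand is also the [y]-derivative of the imaginary part, so the integral
   is a difference of boundary values. *)
have dI y : `[0, W]%classic y ->
    is_derive y 1 (fun t => Im (f (x +i* t)%C)) (Re (f' (x +i* y)%C)).
  by move=> Iy; have [] := df _ _ (Sxy _ _ Ix Iy).
rewrite /Rintegral (@continuous_FTC2 _ _ (fun t => Im (f (x +i* t)%C)))//.
- apply: continuous_in_subspaceT => y; rewrite inE => Iy.
  by have [_ _ /is_derive_continuous] := df' _ _ (Sxy _ _ Ix Iy).
- split.
  + move=> y yW; have [] := dI y => //; exact: subset_itv_oo_cc.
  + apply: cvg_at_right_filter; apply: is_derive_continuous; apply: dI.
    by rewrite /= in_itv/= lexx ltW.
  + apply: cvg_at_left_filter; apply: is_derive_continuous; apply: dI.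
    by rewrite /= in_itv/= lexx ltW.
- by move=> y yW; rewrite derive1E; have [_ ->] := dI _ (subset_itv_oo_cc yW).
Qed.

(** Moving the left side of the rectangle to the right side costs at most [K * (u - x)], by the mean
    value theorem: the bottom side contributes nothing and the top side is bounded by [K]. The right
    side itself contributes at most [K * W]. *)
Lemma elem_strip_integral_le x0 x1 W f (x u K : R) : 0 < W ->
  elem (strip x0 x1 W) f -> x0 < x -> x < u -> u < x1 ->
  (forall t, x <= t <= u -> Im (f (t +i* 0)%C) = 0) ->
  (forall t, x <= t <= u -> `|Im (f (t +i* W)%C)| <= K) ->
  (forall y, 0 <= y <= W -> `|Re (f (u +i* y)%C)| <= K) ->
  `|\int[mu]_(y in `[0, W]) Re (f (x +i* y)%C)| <= K * (u - x + W).
Proof.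
move=> W0 ef x0x xu ux1 f0 fW fu.
pose F t := \int[mu]_(y in `[0, W]) Re (f (t +i* y)%C).
have dF t : x <= t <= u -> is_derive t 1 F (Im (f (t +i* W)%C) - Im (f (t +i* 0)%C)).
  move=> /andP[xt tu]; apply: (elem_strip_derive W0 ef).
    exact: lt_le_trans xt.
  exact: le_lt_trans ux1.
have [| |c cxu FE] := @MVT R F (fun t => Im (f (t +i* W)%C) - Im (f (t +i* 0)%C)) _ _ xu.
- by move=> t txu; apply: dF; move: (subset_itv_oo_cc txu); rewrite in_itv.
- apply: continuous_in_subspaceT => t; rewrite inE/= in_itv/= => txu.
  exact: is_derive_continuous (dF _ txu).
have {}cxu : x <= c <= u by move: (subset_itv_oo_cc cxu); rewrite in_itv.
rewrite -/(F x) (_ : F x = F u - (F u - F x)); last by ring.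
rewrite FE f0// subr0 (le_trans (ler_normB _ _))// [leRHS]mulrDr [leRHS]addrC lerD//; last first.
  have ux0 : 0 <= u - x by rewrite subr_ge0 ltW.
  by rewrite normrM (ger0_norm ux0) ler_wpM2r// fW.
have [f' _ df] := elem_partial ef.
have cfu y : 0 <= y <= W -> {for y, continuous (fun y => Re (f (u +i* y)%C))}.
  move=> /andP[y0 yW]; have [|_ _ /is_derive_continuous//] := df u y.
  by split => //=; exact: lt_trans xu.
have iu := continuous_integrable_itv cfu.
have iuK : mu.-integrable `[0, W] (EFin \o (fun=> K)).
  by apply: continuous_integrable_itv => y _; exact: cst_continuous.
have iun : mu.-integrable `[0, W] (EFin \o (fun y => `|Re (f (u +i* y)%C)|)).
  apply: continuous_integrable_itv => y yW.
  by apply: continuous_comp; [exact: cfu|exact: norm_continuous].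
have KW : \int[mu]_(_ in `[0, W]) K = K * W.
  by rewrite Rintegral_cst//= lebesgue_measure_itv/= lte_fin W0 sube0.
rewrite (le_trans (le_normr_Rintegral _ iu))// -KW le_Rintegral//.
Qed.

End rectangle.

(** * The delay integral *)

Lemma lipschitz_of_derive (R : realType) (f df : R -> R) (a b K x y : R) :
  (forall t, a <= t <= b -> is_derive t 1 f (df t)) ->
  (forall t, a <= t <= b -> `|df t| <= K) ->
  a <= x <= b -> a <= y <= b -> `|f y - f x| <= K * `|y - x|.
Proof.
move=> fdf dfK; wlog xy : x y / x <= y.
  move=> h xab yab; have [xy|/ltW yx] := leP x y; first exact: h.
  by rewrite distrC (distrC y); exact: h.
move=> /andP[ax xb] /andP[ay yb].
move: xy; rewrite le_eqVlt => /predU1P[->|xy]; first by rewrite !subrr normr0 mulr0.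
have sub t : x <= t <= y -> a <= t <= b.
  by move=> /andP[xt ty]; rewrite (le_trans ax xt) (le_trans ty yb).
have [| |c cxy ->] := @MVT R f df _ _ xy.
- by move=> t /subset_itv_oo_cc; rewrite in_itv/= => txy; exact/fdf/sub.
- apply: continuous_in_subspaceT => t; rewrite inE/= in_itv/= => txy.
  by apply: is_derive_continuous; exact/fdf/sub.
rewrite normrM ler_wpM2r//; apply/dfK/sub.
by move: (subset_itv_oo_cc cxy); rewrite in_itv.
Qed.

Lemma cos_lipschitz (R : realType) (x y : R) : `|cos y - cos x| <= `|y - x|.
Proof.
rewrite -[leRHS]mul1r.
apply: (@lipschitz_of_derive _ _ (fun t => - sin t) (Num.min x y) (Num.max x y)).
- by move=> t _; rewrite normrN; exact: sin_max.
- by rewrite ge_min lexx le_max lexx.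
- by rewrite ge_min lexx orbT le_max lexx orbT.
Qed.

Lemma sin_lipschitz (R : realType) (x y : R) : `|sin y - sin x| <= `|y - x|.
Proof.
rewrite -[leRHS]mul1r.
apply: (@lipschitz_of_derive _ _ cos (Num.min x y) (Num.max x y)).
- by move=> t _; exact: cos_max.
- by rewrite ge_min lexx le_max lexx.
- by rewrite ge_min lexx orbT le_max lexx orbT.
Qed.

Lemma cos_gt0_itv (R : realType) (a : R) : 0 <= a -> a < pi / 2 -> 0 < cos a.
Proof.
move=> a0 api; apply: cos_gt0_pihalf; rewrite api andbT (lt_le_trans _ a0)//.
by rewrite oppr_lt0 divr_gt0// pi_gt0.
Qed.

Lemma sin_lt1 (R : realType) (a : R) : 0 <= a -> a < pi / 2 -> sin a < 1.
Proof.
move=> a0 api; rewrite lt_neqAle sin_le1 andbT; apply/eqP => s1.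
have := cos2sin2 a; rewrite s1 expr1n subrr => /eqP.
by rewrite sqrf_eq0 gt_eqF// cos_gt0_itv.
Qed.

Section delay_integral.
Variable R : realType.
Implicit Types (z s : R[i]) (t x y : R).
Notation Re := complex.Re.
Notation Im := complex.Im.
Notation mu := (@lebesgue_measure R).
Import Normc.

Variable a : R.
Hypotheses (a0 : 0 <= a) (api : a < pi / 2).

Let cos_a_gt0 : 0 < cos a. Proof. exact: cos_gt0_itv. Qed.
Let sin_a_lt1 : sin a < 1. Proof. exact: sin_lt1. Qed.

Let c : R := cos a / (2 * (1 - sin a)).

Let c_ge0 : 0 <= c.
Proof. by rewrite /c divr_ge0 ?mulr_ge0 ?subr_ge0 ?ltW. Qed.

(** With [c_cos], this is the real and imaginary part of the equation [N i = 0]. *)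
Let c_sin : c * (1 - sin a) = cos a / 2.
Proof. by rewrite /c; field; rewrite subr_eq0 gt_eqF. Qed.

Let c_cos : c * cos a = (1 + sin a) / 2.
Proof.
rewrite /c -mulrA [_^-1 * _]mulrC mulrA -expr2 cos2sin2.
by field; rewrite subr_eq0 gt_eqF.
Qed.

(** Characteristic function of the scalar delay equation with unit gain and delay [a]. *)
Definition delayF z := z + cexp (- a) z.
(* N vanishes at [i], so that g is bounded near this zero of [1 + z * z]. *)
Let N z := (2^-1%:C%C + c%:C%C * z) * cexp (- a) z + ((- 2^-1)%:C%C * z + c%:C%C * (z * z)).
Let A z := (1 + z * z)^-1.
(** The subtracted fraction cancels the tail c / z at infinity; on the imaginary axis its real part
    integrates to an arctangent. *)
Let g z := N z * A z * (delayF z)^-1 + (- c)%:C%C * (z + 1)^-1.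

(** The closed first quadrant suffices, because [g] is real on the real axis and the final integrand
    is even. *)
Let Q z := 0 <= Re z /\ 0 <= Im z.

Let cexpE z : cexp (- a) z =
  (expR (- (a * Re z)) * cos (a * Im z) -i* (expR (- (a * Re z)) * sin (a * Im z)))%C.
Proof.
by rewrite /cexp !mulNr cosN sinN; apply/eqP; rewrite eq_complex/=; apply/andP;
  split; apply/eqP; ring.
Qed.

Let normc_exp z : 0 <= Re z -> normc (cexp (- a) z) <= 1.
Proof.
move=> z0; rewrite normc_cexp mulNr -expR0 ler_expR oppr_le0.
by rewrite mulr_ge0.
Qed.

Let normcB_le z s : normc z - normc s <= normc (z + s).
Proof.
rewrite lerBlDr -(normc_opp s) -{1}(addrK s z); exact: normcD_le.
Qed.

(** Fix [b] strictly between [a] and pi / 2. If [a * Im z <= b], the cosine is at least [cos b] and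
    the real part is bounded below. Otherwise [Im z] exceeds 1 by a fixed amount, while the
    exponential term has modulus at most 1, so the imaginary part is bounded below. *)
Let delayF_lb : exists2 d, 0 < d & forall z, Q z -> d <= normc (delayF z).
Proof.
have [b ab bpi] : exists2 b, a < b & b < pi / 2.
  by exists ((a + pi / 2) / 2); move: api; lra.
have b0 : 0 <= b by rewrite (le_trans a0)// ltW.
pose k := cos b.
have pi2 : 0 < pi :> R := pi_gt0 R.
have k0 : 0 < k by apply: cos_gt0_pihalf; apply/andP; split; lra.
exists (Num.min (Num.min 1 (k * expR (- a))) ((b - a) / 2)).
  by rewrite !lt_min ltr01 mulr_gt0 ?expR_gt0//= divr_gt0// subr_gt0.
move=> z [z1 z2]; pose q := expR (- (a * Re z)).
have q0 : 0 < q by exact: expR_gt0.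
have q1 : q <= 1 by rewrite /q -expR0 ler_expR oppr_le0 mulr_ge0.
have [azb|baz] := leP (a * Im z) b.
- have ck : k <= cos (a * Im z).
    rewrite /k leNgt ltr_cos ?in_itv/= ?ltNge ?azb//; apply/andP; split; try lra.
      by rewrite mulr_ge0.
  rewrite (le_trans _ (Re_normc _))// (le_trans _ (ler_norm _))//.
  rewrite /delayF cexpE ReD /= -/q !ge_min; apply/orP; left; apply/orP.
  have [z11|/ltW z11] := leP 1 (Re z).
    left; rewrite (le_trans z11)// lerDl mulr_ge0 ?ltW// (lt_le_trans k0)//.
  right; rewrite (@le_trans _ _ (q * cos (a * Im z)))//; last by rewrite lerDr.
  rewrite [leRHS]mulrC; apply: ler_pM => //; first exact: ltW.
  by rewrite /q ler_expR lerN2 ler_piMr.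
- have z21 : 1 < Im z.
    rewrite ltNge; apply/negP => z21; have : a * Im z <= a by rewrite ler_piMr.
    by move: baz; lra.
  rewrite (le_trans _ (Im_normc _))// (le_trans _ (ler_norm _))//.
  rewrite /delayF cexpE ImD /= -/q ge_min; apply/orP; right.
  have qs : q * sin (a * Im z) <= 1.
    by rewrite (le_trans (ler_wpM2l (ltW q0) (sin_le1 _)))// mulr1.
  (* From pi / 2 < 2; this explains the denominator 2 in the bound [(b - a) / 2]. *)
  have a2 : a <= 2 by have := @pihalf_lt2 R; move: api; lra.
  have : a * (Im z - 1) <= 2 * (Im z - 1) by rewrite ler_wpM2r// subr_ge0 ltW.
  by move: baz qs; lra.
Qed.

Let delayF_lb2 z : Q z -> normc z - 1 <= normc (delayF z).
Proof.
by move=> [z1 z2]; rewrite (le_trans _ (normcB_le _ _))// lerB// normc_exp.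
Qed.

Let i : R[i] := (0 +i* 1)%C.

Let Ni : N i = 0.
Proof.
rewrite /N cexpE /i /= mulr0 oppr0 expR0 mulr1 !mul1r.
apply/eqP; rewrite eq_complex /= ; apply/andP; split; apply/eqP.
- by move: c_sin; lra.
- by move: c_cos; lra.
Qed.

(** The change of modulus costs [a] times the distance, and the cosine and the sine of the phase
    cost [a] each. *)
Let exp_lip z : Q z -> normc (cexp (- a) z - cexp (- a) i) <= 3 * a * normc (z - i).
Proof.
move=> [z1 z2]; pose q := expR (- (a * Re z)).
have q1 : q <= 1 by rewrite /q -expR0 ler_expR oppr_le0 mulr_ge0.
have q2 : 1 - a * Re z <= q by rewrite /q; exact: expR_ge1Dx.
pose u y := (cos (a * y) -i* sin (a * y))%C.
have -> : cexp (- a) z - cexp (- a) i = (q - 1)%:C%C * u (Im z) + (u (Im z) - u 1).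
  rewrite !cexpE /i /= mulr0 oppr0 expR0 -/q /u; apply/eqP; rewrite eq_complex /=.
  by apply/andP; split; apply/eqP; ring.
have r1 : `|Re z| <= normc (z - i).
  by rewrite (le_trans _ (Re_normc _))// ReD /i /= oppr0 addr0.
have r2 : `|Im z - 1| <= normc (z - i).
  by rewrite (le_trans _ (Im_normc _))// ImD /i /=.
rewrite (le_trans (normcD_le _ _))//.
have h1 : normc ((q - 1)%:C%C * u (Im z)) <= a * normc (z - i).
  rewrite normcM normc_real /= sqrrN cos2Dsin2 sqrtr1 mulr1 ler0_norm; last by lra.
  have : a * Re z <= a * normc (z - i).
    by rewrite ler_wpM2l// (le_trans _ r1)// ler_norm.
  by lra.
have h2 : normc (u (Im z) - u 1) <= 2 * a * normc (z - i).
  rewrite (le_trans (normc_ReIm _))// /u /= opprK.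
  have h3 : `|a * Im z - a * 1| <= a * normc (z - i).
    by rewrite -mulrBr normrM (ger0_norm a0) ler_wpM2l.
  have := le_trans (cos_lipschitz (a * 1) (a * Im z)) h3.
  have := le_trans (sin_lipschitz (a * 1) (a * Im z)) h3.
  by rewrite (addrC (- sin _)) (distrC (sin (a * 1))) => *; lra.
lra.
Qed.

Let sq_factor z : 1 + z * z = (z - i) * (z + i).
Proof. by case: z => x y; apply/eqP; rewrite eq_complex /=; apply/andP; split; apply/eqP; ring. Qed.

Let sq_lb z : 2 <= normc z -> 3 / 4 * normc z ^+ 2 <= normc (1 + z * z).
Proof.
move=> z2; rewrite addrC (le_trans _ (normcB_le _ _))// normcM normc1.
by move: z2; nra.
Qed.

(** [K2] serves for modulus at least 2, where both sides grow quadratically. [K1] serves for smaller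
    modulus, where the zero of [N] at [i] has to compensate that of [1 + z * z]. *)
Let N_le : exists2 K, 0 <= K & forall z, Q z -> normc (N z) <= K * normc (1 + z * z).
Proof.
pose K1 := (2^-1 + 2 * c) * (3 * a) + (4 * c + 2^-1).
pose K2 := 4 / 3 * (2 * c + 1).
have K10 : 0 <= K1.
  by rewrite /K1; do ?[by []|apply: addr_ge0|apply: mulr_ge0]; rewrite ?invr_ge0.
have K20 : 0 <= K2.
  by rewrite /K2; do ?[by []|apply: addr_ge0|apply: mulr_ge0]; rewrite ?invr_ge0.
exists (K1 + K2); first by rewrite addr_ge0.
move=> z Qz; have [z1 z2] := Qz; have n0 := normc_ge0 (1 + z * z).
have e1 := normc_exp z1.
have K1n : 0 <= K1 * normc (1 + z * z) by exact: mulr_ge0.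
have K2n : 0 <= K2 * normc (1 + z * z) by exact: mulr_ge0.
have [z2'|z2'] := leP 2 (normc z).
- rewrite mulrDl ler_wpDl//.
  rewrite (@le_trans _ _ (K2 * (3 / 4 * normc z ^+ 2)))//; last first.
    by rewrite ler_wpM2l// sq_lb.
  have h1 : normc ((2^-1%:C%C + c%:C%C * z) * cexp (- a) z) <= 2^-1 + c * normc z.
    rewrite normcM -[leRHS]mulr1 ler_pM ?normc_ge0//.
    by rewrite (le_trans (normcD_le _ _))// normcM !normc_real !ger0_norm// invr_ge0.
  have h2 : normc ((- 2^-1)%:C%C * z + c%:C%C * (z * z)) <= 2^-1 * normc z + c * normc z ^+ 2.
    rewrite (le_trans (normcD_le _ _))// !normcM !normc_real normrN !ger0_norm// ?invr_ge0//.
  rewrite (le_trans (normcD_le _ _))// (le_trans (lerD h1 h2))// /K2.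
  have : 0 <= c * (normc z ^+ 2 - normc z) by rewrite mulr_ge0// subr_ge0; nra.
  by nra.
- rewrite mulrDl ler_wpDr//.
  have zi : 1 <= normc (z + i).
    rewrite (le_trans _ (Im_normc _))// (le_trans _ (ler_norm _))// ImD /i /=.
    by rewrite lerDr.
  rewrite sq_factor normcM (@le_trans _ _ (K1 * normc (z - i)))//; last first.
    by rewrite ler_wpM2l// ler_peMr ?normc_ge0.
  (* Subtracting [N i = 0] brings out increments that are all of order [z - i]. *)
  have -> : N z = (2^-1%:C%C + c%:C%C * z) * (cexp (- a) z - cexp (- a) i)
      + (z - i) * (c%:C%C * cexp (- a) i + ((- 2^-1)%:C%C + c%:C%C * (z + i))).
    by rewrite -[N z]subr0 -Ni /N; ring.
  rewrite (le_trans (normcD_le _ _))// [in leLHS]normcM [normc ((z - i) * _)]normcM.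
  have h1 : normc (2^-1%:C%C + c%:C%C * z) <= 2^-1 + 2 * c.
    rewrite (le_trans (normcD_le _ _))// normcM !normc_real !ger0_norm ?invr_ge0//.
    by rewrite lerD2l mulrC ler_wpM2r// ltW.
  have h2 : normc (c%:C%C * cexp (- a) i + ((- 2^-1)%:C%C + c%:C%C * (z + i)))
      <= 4 * c + 2^-1.
    have hi : normc (z + i) <= 3.
      rewrite (le_trans (normcD_le _ _))//.
      have -> : normc i = 1 by rewrite normc_imag normr1.
      by move: z2'; lra.
    rewrite (le_trans (normcD_le _ _))//.
    have -> : 4 * c + 2^-1 = c * 1 + (2^-1 + c * 3) by ring.
    rewrite lerD//.
      by rewrite normcM normc_real ger0_norm// ler_wpM2l// normc_exp.
    rewrite (le_trans (normcD_le _ _))// lerD//.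
      by rewrite normc_real normrN ger0_norm// invr_ge0.
    by rewrite normcM normc_real ger0_norm// ler_wpM2l.
  rewrite /K1 mulrDl lerD//.
    rewrite -mulrA ler_pM ?normc_ge0//; exact: exp_lip.
  by rewrite mulrC ler_wpM2r ?normc_ge0.
Qed.

Let z1_lb z : Q z -> 1 <= normc (z + 1).
Proof.
move=> [z1 _]; rewrite (le_trans _ (Re_normc _))// (le_trans _ (ler_norm _))//.
by rewrite ReD /= lerDr.
Qed.

Let g_bounded : exists2 K, 0 <= K & forall z, Q z -> normc (g z) <= K.
Proof.
have [K K0 NK] := N_le; have [d d0 Fd] := delayF_lb.
exists (K / d + c); first by rewrite addr_ge0// divr_ge0// ltW.
move=> z Qz; rewrite (le_trans (normcD_le _ _))// lerD//.
  rewrite normcM ler_pM ?normc_ge0//.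
    rewrite normcM /A normcV.
    (* At [z = i] the inverse of zero is zero, so the bound persists there. *)
    have [->|n0] := eqVneq (normc (1 + z * z)) 0; first by rewrite invr0 mulr0.
    by rewrite ler_pdivrMr ?NK// lt_def n0 normc_ge0.
  by rewrite normcV lef_pV2 ?posrE ?Fd// (lt_le_trans d0)// Fd.
rewrite normcM normc_real normrN (ger0_norm c_ge0) normcV ler_piMr//.
rewrite invf_le1 ?z1_lb//; exact: lt_le_trans (z1_lb Qz).
Qed.

(** Over the denominator [delayF z * (z + 1)], of modulus at least a quarter of the squared modulus
    of [z], the numerator stays bounded by [K3]. *)
Let g_decay : exists2 K, 0 <= K & forall z, Q z -> 2 <= normc z ->
  normc (g z) <= K / normc z ^+ 2.
Proof.
pose K3 := 8 / 3 * (2 * c + 1) + 2 * c.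
have K30 : 0 <= K3.
  by rewrite /K3; do ?[by []|apply: addr_ge0|apply: mulr_ge0]; rewrite ?invr_ge0.
exists (4 * K3); first by rewrite mulr_ge0.
move=> z Qz z2; have [z1 _] := Qz; have r0 : 0 < normc z by rewrite (lt_le_trans _ z2).
have e1 := normc_exp z1.
have F2 : normc z / 2 <= normc (delayF z).
  by rewrite (le_trans _ (delayF_lb2 Qz))//; move: z2; lra.
have p2 : normc z / 2 <= normc (z + 1).
  by rewrite (le_trans _ (normcB_le _ _))// normc1; move: z2; lra.
have q2 := sq_lb z2.
have F0 : delayF z != 0 by apply: normc_neq0; rewrite (lt_le_trans _ F2)// divr_gt0.
have p0 : z + 1 != 0 by apply: normc_neq0; rewrite (lt_le_trans _ p2)// divr_gt0.
have q0' : 0 < 3 / 4 * normc z ^+ 2 by rewrite mulr_gt0// exprn_gt0.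
have q0 : 1 + z * z != 0 by apply: normc_neq0; rewrite (lt_le_trans _ q2).
(* [B] is [N z - c * (1 + z * z)], of first degree in [z]; splitting it off makes the terms [c * z]
   of the numerator cancel. *)
pose B := (c%:C%C * cexp (- a) z + (- 2^-1)%:C%C) * z + (2^-1%:C%C * cexp (- a) z + (- c)%:C%C).
have gE : g z = (B / (1 + z * z) * (z + 1) + c%:C%C * (1 + - cexp (- a) z))
    / (delayF z * (z + 1)).
  rewrite /g /N /A /B !rmorphN/=; rewrite /delayF in F0 *.
  by field; rewrite p0 F0 q0.
have hB : normc B <= (2 * c + 1) * normc z.
  have h1 : normc (c%:C%C * cexp (- a) z + (- 2^-1)%:C%C) <= c + 2^-1.
    rewrite (le_trans (normcD_le _ _))// lerD//.
      by rewrite normcM normc_real ger0_norm// ler_piMr.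
    by rewrite normc_real normrN ger0_norm// invr_ge0.
  have h2 : normc (2^-1%:C%C * cexp (- a) z + (- c)%:C%C) <= 2^-1 + c.
    rewrite (le_trans (normcD_le _ _))// lerD//.
      by rewrite normcM normc_real ger0_norm ?invr_ge0// ler_piMr// invr_ge0.
    by rewrite normc_real normrN ger0_norm.
  rewrite (le_trans (normcD_le _ _))// normcM.
  have : normc (c%:C%C * cexp (- a) z + (- 2^-1)%:C%C) * normc z <= (c + 2^-1) * normc z.
    by rewrite ler_wpM2r// ltW.
  have : (c + 2^-1) * 2 <= (c + 2^-1) * normc z.
    by rewrite ler_wpM2l// addr_ge0// invr_ge0.
  by move: h2 c_ge0; lra.
have hnum : normc (B / (1 + z * z) * (z + 1) + c%:C%C * (1 + - cexp (- a) z)) <= K3.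
  rewrite (le_trans (normcD_le _ _))// lerD//.
    rewrite normcM normcM normcV.
    have h1 : normc B / normc (1 + z * z) <= (2 * c + 1) * normc z / (3 / 4 * normc z ^+ 2).
      rewrite ler_pM ?invr_ge0 ?normc_ge0//.
      by rewrite lef_pV2 ?posrE// (lt_le_trans q0').
    have h2 : normc (z + 1) <= 2 * normc z.
      by rewrite (le_trans (normcD_le _ _))// normc1; move: z2; lra.
    have h3 : (2 * c + 1) * normc z / (3 / 4 * normc z ^+ 2) * (2 * normc z)
        = 8 / 3 * (2 * c + 1).
      by field; rewrite gt_eqF.
    by rewrite -h3 ler_pM// ?normc_ge0// mulr_ge0 ?invr_ge0 ?normc_ge0.
  rewrite normcM normc_real ger0_norm// mulrC ler_wpM2r//.
  by rewrite (le_trans (normcD_le _ _))// normc1 normc_opp; move: e1; lra.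
rewrite gE normcM normcV normcM.
have -> : 4 * K3 / normc z ^+ 2 = K3 * (normc z / 2 * (normc z / 2))^-1.
  by field; rewrite gt_eqF.
have zz : 0 < normc z / 2 * (normc z / 2) by rewrite mulr_gt0 ?divr_gt0.
have zz' : normc z / 2 * (normc z / 2) <= normc (delayF z) * normc (z + 1).
  by rewrite ler_pM// divr_ge0// ltW.
rewrite ler_pM ?normc_ge0 ?invr_ge0 ?mulr_ge0 ?normc_ge0//.
by rewrite lef_pV2 ?posrE// (lt_le_trans zz).
Qed.

Let g_elem (S : R[i] -> Prop) e : (forall z, S z -> Q z) -> 0 < e ->
  (forall z, S z -> e <= normc (1 + z * z)) -> elem S g.
Proof.
move=> SQ e0 Se; have [d d0 Fd] := delayF_lb.
have ee : elem S (cexp (- a)) by exact: elem_exp.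
have ei : elem S (fun z => z) by exact: elem_id.
have ec k : elem S (fun=> k) by exact: elem_cst.
apply: elemD.
  apply: elemM.
    apply: elemM.
      apply: elemD; first by apply: elemM => //; apply: elemD => //; apply: elemM.
      by apply: elemD; apply: elemM => //; apply: elemM.
    apply: (@elemV _ _ (fun z => 1 + z * z) e) => //.
    by apply: elemD => //; apply: elemM.
  apply: (@elemV _ _ _ d) => //; first exact: elemD.
  by move=> z /SQ; exact: Fd.
apply: elemM => //; apply: (@elemV _ _ (fun z => z + 1) 1); rewrite ?ltr01//.
  exact: elemD.
by move=> z /SQ; exact: z1_lb.
Qed.

(** To the right of the abscissa [x0], both [z - i] and [z + i] have modulus at least [x0]. *)
Let g_elem_strip x0 x1 W : 0 < x0 -> elem (strip x0 x1 W) g.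
Proof.
move=> x00; apply: (@g_elem _ (x0 * x0)); rewrite ?mulr_gt0//.
  by move=> z [h1 _ h2 _]; split => //; rewrite ltW// (lt_trans x00).
move=> z [h1 _ _ _]; rewrite sq_factor normcM; rewrite ler_pM ?(ltW x00)//.
  rewrite (le_trans _ (Re_normc _))// (le_trans _ (ler_norm _))// ReD /i/=.
  by rewrite oppr0 addr0 ltW.
rewrite (le_trans _ (Re_normc _))// (le_trans _ (ler_norm _))// ReD /i/=.
by rewrite addr0 ltW.
Qed.

(** All coefficients are real; hence the bottom side of the rectangle drops out. *)
Let g_real t : Im (g (t +i* 0)%C) = 0.
Proof.
have r (k : R) : (k%:C)%C \is Num.real by apply/complex_realP; exists k.
have re : cexp (- a) (t +i* 0)%C \is Num.real.
  by rewrite cexpE /= mulr0 sin0 mulr0 oppr0; exact: r.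
have rt : (t +i* 0)%C \is Num.real by exact: r.
suff : g (t +i* 0)%C \is Num.real by case/complex_realP => k ->.
rewrite /g /N /A /delayF.
by do ! first [exact: r|exact: re|exact: rt|exact: rpred1|apply: rpredD|apply: rpredM|rewrite rpredV].
Qed.

(** The squared modulus of [delayF] at the imaginary point i y. *)
Definition delayD y := 1 + y ^+ 2 - 2 * y * sin (a * y).

Let delayDE y : delayD y = cos (a * y) ^+ 2 + (y - sin (a * y)) ^+ 2.
Proof. by rewrite cos2sin2 /delayD; ring. Qed.

Lemma delayD_gt0 y : 0 < delayD y.
Proof.
wlog y0 : y / 0 <= y.
  move=> h; have [|/ltW yn] := leP 0 y; first exact: h.
  by have := h (- y); rewrite oppr_ge0 => /(_ yn); rewrite /delayD sqrrN !mulrN sinN mulNr mulrN opprK.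
have [d d0 Fd] := delayF_lb.
have Qy : Q (0 +i* y)%C by split.
have F0 : delayF (0 +i* y)%C != 0.
  by apply: normc_neq0; rewrite (lt_le_trans d0)// Fd.
have := complex_sqnorm_neq0 F0; rewrite /delayF cexpE /= mulr0 oppr0 expR0 !mul1r add0r.
by rewrite -delayDE => D0; rewrite lt_def D0 delayDE addr_ge0// sqr_ge0.
Qed.

Let g_imag y : 0 <= y -> y != 1 ->
  Re (g (0 +i* y)%C) = (2 * delayD y)^-1 - c * (1 + y ^+ 2)^-1.
Proof.
move=> y0 y1; have D0 := delayD_gt0 y.
have AE : A (0 +i* y)%C = ((1 - y ^+ 2)^-1)%:C%C.
  by rewrite fmorphV /A; congr (_^-1); apply/eqP; rewrite eq_complex /=;
     apply/andP; split; apply/eqP; ring.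
have y2 : 1 - y ^+ 2 != 0.
  rewrite subr_eq0 eq_sym sqrf_eq1 negb_or y1/=.
  by apply/eqP => ym; move: y0; rewrite ym; lra.
have ReMV (u w : R[i]) r : Re (u * r%:C%C * w^-1) =
    r * ((Re u * Re w + Im u * Im w) / (Re w ^+ 2 + Im w ^+ 2)).
  by rewrite !(ReM, ImM) ReV ImV /=; ring.
rewrite /g AE ReD ReMV; congr (_ + _); last first.
  by rewrite ReM ReV ImV ReD ImD /= add0r addr0 expr1n; ring.
have eE : cexp (- a) (0 +i* y)%C = (cos (a * y) -i* sin (a * y))%C.
  by rewrite cexpE /= mulr0 oppr0 expR0 !mul1r.
rewrite /N /delayF eE /=.
set den := (X in _ * (_ / X)); have -> : den = delayD y by rewrite /den delayDE add0r.
set C := cos (a * y); set S := sin (a * y); set num := (X in _ * (X / _)).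
(* All terms in [c] cancel, and by [cos2Dsin2] the numerator becomes (1 - y^2) / 2, which absorbs
   the factor [A]. *)
have -> : num = (C ^+ 2 + S ^+ 2 - y ^+ 2) / 2 by rewrite /num; field.
by rewrite cos2Dsin2; field; rewrite y2 gt_eqF.
Qed.

Lemma continuous_delayDV : continuous (fun y => (delayD y)^-1).
Proof.
move=> y; apply: cvgV; first by rewrite gt_eqF// delayD_gt0.
apply: cvgD; first by apply: cvgD; [exact: cvg_cst|exact: exprn_continuous].
apply: cvgN; apply: cvgM; first by apply: cvgM; [exact: cvg_cst|exact: cvg_id].
apply: (@continuous_comp _ _ _ (fun y => a * y) sin); first exact: mulrl_continuous.
exact: continuous_sin.
Qed.

Let hd y := (2 * delayD y)^-1 - c * (1 + y ^+ 2)^-1.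

Let continuous_hd : continuous hd.
Proof.
rewrite (_ : hd = fun y => 2^-1 * (delayD y)^-1 - c * (1 + y ^+ 2)^-1); last first.
  by apply/funext => y; rewrite /hd invfM.
move=> y; apply: cvgB.
  by apply: cvgM; [exact: cvg_cst|exact: continuous_delayDV].
by apply: cvgM; [exact: cvg_cst|exact: (@continuous_oneDsqrV R)].
Qed.

(* In the proof, f x is the integrand of g on the vertical line of abscissa `|x|,
   extended by continuity at the removable singularity [i]; the rectangle
   estimate holds for x != 0 and passes to the limit. *)
Let hd_bound : exists2 K, 0 <= K &
  forall W, 2 <= W -> `|\int[mu]_(y in `[0, W]) hd y| <= K / W.
Proof.
have [K K0 gK] := g_decay; have [Kb Kb0 gKb] := g_bounded.
exists (2 * K); first by rewrite mulr_ge0.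
move=> W W2; have W0 : 0 < W by rewrite (lt_le_trans _ W2).
pose f x y := if x == 0 then hd y else Re (g (`|x| +i* y)%C).
have fS x : x != 0 -> elem (strip (`|x| / 2) (`|x| + W + 1) W) g.
  by move=> x0; apply: g_elem_strip; rewrite divr_gt0// normr_gt0.
have f_le x : x != 0 -> `|x| < 1 -> `|\int[mu]_(y in `[0, W]) f x y| <= 2 * K / W.
  move=> x0 x1; have nx0 : 0 < `|x| by rewrite normr_gt0.
  have gW z : Q z -> W <= normc z -> normc (g z) <= K / W ^+ 2.
    move=> Qz Wz; rewrite (le_trans (gK _ Qz (le_trans W2 Wz)))//.
    rewrite ler_wpM2l// lef_pV2 ?posrE ?exprn_gt0//; last exact: lt_le_trans Wz.
    by rewrite lerXn2r// nnegrE ?ltW// (lt_le_trans W0).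
  (* The rectangle has vertical sides at [|x|] and [W], and height [W]. On its top and right sides
     the modulus is at least [W], so [K / W ^+ 2] bounds the integrand over a length of at most
     [2 * W]. *)
  have -> : \int[mu]_(y in `[0, W]) f x y = \int[mu]_(y in `[0, W]) Re (g (`|x| +i* y)%C).
    by apply: eq_Rintegral => y _; rewrite /f (negPf x0).
  rewrite (le_trans (@elem_strip_integral_le _ _ _ _ _ _ W (K / W ^+ 2) W0 (fS x x0) _ _ _ _ _ _))//.
  - by rewrite ltr_pdivrMr// mulr_natr mulr2n ltrDl.
  - by rewrite (lt_le_trans x1)// (le_trans _ W2)// ler1n.
  - by rewrite -addrA ltr_wpDl// ltrDl.
  - move=> t /andP[xt tW]; rewrite (le_trans (Im_normc _))// gW//.
      by split => /=; [exact: le_trans xt|exact: ltW].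
    by rewrite (le_trans _ (Im_normc _))//= ler_norm.
  - move=> y /andP[y0 yW]; rewrite (le_trans (Re_normc _))// gW//.
      by split => //=; exact: ltW.
    by rewrite (le_trans _ (Re_normc _))//= ler_norm.
  rewrite (_ : 2 * K / W = K / W ^+ 2 * (2 * W)); last by field; rewrite gt_eqF.
  apply: ler_wpM2l; last by move: nx0; lra.
  by rewrite divr_ge0// exprn_ge0// ltW.
have mW : measurable (`[0, W]%classic : set (measurableTypeR R)) by exact: measurable_itv.
have int_f x : `](-1), 1[%classic x -> mu.-integrable `[0, W] (EFin \o f x).
  move=> _; apply: continuous_integrable_itv => y /andP[y0 yW].
  have [->|x0] := eqVneq x 0.
    by rewrite /f eqxx; exact: continuous_hd.
  have [f' _ df] := elem_partial (fS x x0).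
  rewrite /f (negPf x0).
  have [|_ _ /is_derive_continuous//] := df `|x| y.
  have nx0 : 0 < `|x| by rewrite normr_gt0.
  by split => //=; move: nx0 W0; lra.
have fE y : 0 <= y -> y != 1 -> forall x, f x y = Re (g (`|x| +i* y)%C).
  move=> y0 y1 x; rewrite /f; case: eqVneq => [->|//].
  by rewrite normr0 g_imag.
have mu1 : mu.-negligible [set 1 : R].
  by exists [set 1]; split => //; rewrite lebesgue_measure_set1.
have cf : {ae mu, forall y, `[0, W]%classic y -> {in `](-1), 1[%classic, continuous (f ^~ y)}}.
  apply: negligibleS mu1 => y /= h; apply: contrapT => /eqP y1; apply: h.
  rewrite in_itv/= => /andP[y0 yW] x _.
  have -> : f ^~ y = fun x => Re (g (`|x| +i* y)%C) by apply/funext => t; rewrite fE.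
  (* A region reduced to one point is enough, since differentiability is asserted pointwise; for
     [y != 1] this includes the imaginary axis. *)
  have eg : elem (fun z => z = (`|x| +i* y)%C) g.
    have Qz : Q (`|x| +i* y)%C by split => /=.
    apply: (@g_elem _ (normc (1 + (`|x| +i* y)%C * (`|x| +i* y)%C))).
    - by move=> z ->.
    - rewrite lt_def normc_ge0 andbT; apply/eqP => /eq0_normc /eqP.
      rewrite sq_factor mulf_eq0 /i !eq_complex /= => /orP[|] /andP[_].
        by rewrite subr_eq0 (negPf y1).
      by rewrite gt_eqF// ltr_wpDl.
    - by move=> z ->.
  have [f' _ df] := elem_partial eg.
  have [/is_derive_continuous cx _ _ _] := df _ _ erefl.
  apply: (@continuous_comp R R R (fun t => `|t|) (fun t => Re (g (t +i* y)%C)) x) => //.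
  exact: norm_continuous.
have int_g : mu.-integrable `[0, W] (EFin \o (fun=> Kb)).
  by apply: continuous_integrable_itv => y _; exact: cst_continuous.
have g_ub x : `](-1), 1[%classic x ->
    {ae mu, forall y, `[0, W]%classic y -> `|f x y| <= Kb}.
  move=> _; apply: negligibleS mu1 => y /= h; apply: contrapT => /eqP y1; apply: h.
  rewrite in_itv/= => /andP[y0 yW]; rewrite fE//.
  by rewrite (le_trans (Re_normc _))// gKb//; split => /=.
have := @continuity_under_integral R _ _ mu f _ mW (-1) 1 int_f cf _ int_g g_ub.
move=> /(_ 0); rewrite inE/= in_itv/= ltrN10 ltr01 => /(_ isT) c0.
rewrite (_ : \int[mu]_(y in `[0, W]) hd y = \int[mu]_(y in `[0, W]) f 0 y); last first.
  by apply: eq_Rintegral => y _; rewrite /f eqxx.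
apply/ler_addgt0Pr => e e0.
move/cvgrPdist_le : c0 => /(_ e e0) [r /= r0 hr].
pose x := Num.min (r / 2) (1 / 2).
have x0 : 0 < x by rewrite lt_min !divr_gt0.
have x1 : x < 1 by rewrite gt_min; apply/orP; right; lra.
have xr : x < r by rewrite gt_min; apply/orP; left; rewrite ltr_pdivrMr// mulr_natr mulr2n ltrDl.
have := hr x; rewrite /= sub0r normrN gtr0_norm// => /(_ xr) h1.
have h2 : `|\int[mu]_(y in `[0, W]) f x y| <= 2 * K / W.
  by apply: f_le; rewrite ?gt_eqF// gtr0_norm.
rewrite -(subrK (\int[mu]_(y in `[0, W]) f x y) (\int[mu]_(y in `[0, W]) f 0 y)).
by rewrite (le_trans (ler_normD _ _))// addrC lerD.
Qed.

(** The integral up to [x] is [2 * (c * atan x)] plus twice the integral of [hd], and the latter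
    tends to zero. The integrand being nonnegative, the limit is the integral over the half-line. *)
Lemma delay_integral_halfline :
  (\int[mu]_(y in `[0%R, +oo[) ((delayD y)^-1)%:E
   = (pi * (cos a / (2 * (1 - sin a))))%:E)%E.
Proof.
have [K K0 hK] := hd_bound.
pose F x := \int[mu]_(y in `[0, x]) (delayD y)^-1.
have iD x : mu.-integrable `[0, x] (EFin \o (fun y => (delayD y)^-1)).
  by apply: continuous_integrable_itv => y _; exact: continuous_delayDV.
have FE x : 0 <= x -> F x = 2 * (c * atan x) + 2 * \int[mu]_(y in `[0, x]) hd y.
  move=> x0.
  have iO : mu.-integrable `[0, x] (EFin \o (fun y => (oneDsqr y)^-1)).
    by apply: continuous_integrable_itv => y _; exact: (@continuous_oneDsqrV R).
  have ih : mu.-integrable `[0, x] (EFin \o hd).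
    by apply: continuous_integrable_itv => y _; exact: continuous_hd.
  have icO : mu.-integrable `[0, x] (EFin \o (fun y => c * (oneDsqr y)^-1)).
    apply: continuous_integrable_itv => y _.
    by apply: cvgM; [exact: cvg_cst|exact: (@continuous_oneDsqrV R)].
  rewrite -integral0_oneDsqr// -RintegralZl// -mulrDr -RintegralD//.
  rewrite -RintegralZl//; last first.
    apply: continuous_integrable_itv => y _.
    apply: cvgD; last exact: continuous_hd.
    by apply: cvgM; [exact: cvg_cst|exact: (@continuous_oneDsqrV R)].
  apply: eq_Rintegral => y _; rewrite /hd /oneDsqr invfM.
  by rewrite addrC subrK mulVKf.
have Fl : F x @[x --> +oo] --> pi * c.
  have -> : pi * c = 2 * (c * (pi / 2)) + 0 by field.
  have h1 : 2 * (c * atan x) @[x --> +oo] --> 2 * (c * (pi / 2)).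
    by apply: cvgM; [exact: cvg_cst|apply: cvgM; [exact: cvg_cst|exact: cvgy_atan]].
  have h2 : (F x - 2 * (c * atan x)) @[x --> +oo] --> (0 : R).
    apply/cvgrPdist_le => e e0; near=> x.
    have x2 : 2 <= x by near: x; exact: nbhs_pinfty_ge.
    have x0 : 0 < x by rewrite (lt_le_trans _ x2).
    have xe : 2 * K / e <= x.
      by near: x; apply: nbhs_pinfty_ge; exact: num_real.
    rewrite sub0r normrN FE ?(ltW x0)// addrC addKr normrM ger0_norm//.
    have := hK x x2 => h; rewrite (le_trans (ler_wpM2l _ h))// mulrA.
    by rewrite ler_pdivrMr// [e * x]mulrC -ler_pdivrMr.
  have <- : (fun x => 2 * (c * atan x) + (F x - 2 * (c * atan x))) = F.
    by apply/funext => x; rewrite addrC subrK.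
  exact: cvgD h1 h2.
have Fd x : 0 < x -> derivable F x 1 /\ F^`() x = (delayD x)^-1.
  move=> x0; apply: (@continuous_FTC1_closed _ _ 0 x (x + 1)) => //.
  - by rewrite ltrDl.
  - exact: continuous_delayDV.
have F0 : F 0 = 0 by rewrite /F set_itv1 Rintegral_set1.
rewrite (@ge0_continuous_FTC2y _ _ F 0 (pi * c))//.
- by rewrite F0 sube0.
- by move=> x _; rewrite invr_ge0 ltW// delayD_gt0.
- by apply: continuous_subspaceT; exact: continuous_delayDV.
- by move=> x /Fd[].
- have := @parameterized_integral_continuous R 0 1 (fun y => (delayD y)^-1) ler01 (iD 1).
  by move=> /continuous_within_itvP => /(_ ltr01)[].
- by move=> x; rewrite in_itv/= andbT => /Fd[].
Unshelve. all: by end_near. Qed.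

Lemma delay_integral :
  (\int[mu]_y ((delayD y)^-1)%:E = (pi * (cos a / (1 - sin a)))%:E)%E.
Proof.
rewrite ge0_symfun_integralT.
- rewrite -set_itvcy delay_integral_halfline -EFinM; congr (_%:E).
  by field; rewrite subr_eq0 gt_eqF.
- by move=> y; rewrite invr_ge0 ltW// delayD_gt0.
- exact: continuous_delayDV.
- by move=> y /=; rewrite /delayD sqrrN !mulrN sinN mulNr mulrN opprK.
Qed.

End delay_integral.

(** * The performance as a spectral function *)

Section performance.
Variable R : realType.
Notation mu := (@lebesgue_measure R).

(* Contribution of one Laplacian eigenvalue x to the performance. *)
Definition perf (tau x : R) := x * cos (tau * x) / (2 * (1 - sin (tau * x))).
Definition dperf (tau x : R) := (cos (tau * x) + tau * x) / (2 * (1 - sin (tau * x))).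

(* [x ^+ 2 / |i om + x exp (- i tau om)| ^+ 2], with junk value 0 at x = om = 0. *)
Definition mode_gain (tau x om : R) :=
  x ^+ 2 / (x ^+ 2 + om ^+ 2 - 2 * x * om * sin (tau * om)).

Lemma mode_gainE tau x om : x != 0 ->
  mode_gain tau x om = (delayD (tau * x) (x^-1 * om))^-1.
Proof.
move=> x0; rewrite /mode_gain /delayD.
have -> : tau * x * (x^-1 * om) = tau * om by field.
have -> : 1 + (x^-1 * om) ^+ 2 - 2 * (x^-1 * om) * sin (tau * om) =
  (x ^+ 2)^-1 * (x ^+ 2 + om ^+ 2 - 2 * x * om * sin (tau * om)) by field.
by rewrite invfM invrK.
Qed.

Lemma continuous_mode_gain tau x : 0 <= tau -> 0 <= x -> tau * x < pi / 2 ->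
  continuous (mode_gain tau x).
Proof.
move=> tau0 x0 txpi; have [->|xn0] := eqVneq x 0.
  have -> : mode_gain tau 0 = cst 0.
    by apply/funext => om; rewrite /mode_gain expr0n/= mul0r.
  exact: cst_continuous.
have -> : mode_gain tau x = (fun y => (delayD (tau * x) y)^-1) \o (fun om => x^-1 * om).
  by apply/funext => om; rewrite mode_gainE.
move=> om; apply: continuous_comp; first exact: mulrl_continuous.
by apply: continuous_delayDV => //; exact: mulr_ge0.
Qed.

Lemma mode_denom_gt0 (tau x om : R) : 0 <= tau -> 0 <= x -> tau * x < pi / 2 -> om != 0 ->
  0 < x ^+ 2 + om ^+ 2 - 2 * x * om * sin (tau * om).
Proof.
move=> tau0 x0 txpi om0; have [->|xn0] := eqVneq x 0.
  by rewrite expr0n/= mulr0 !mul0r subr0 add0r exprn_even_gt0.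
have := delayD_gt0 (mulr_ge0 tau0 x0) txpi (x^-1 * om).
rewrite -invr_gt0 -mode_gainE// /mode_gain pmulr_rgt0 ?invr_gt0//.
by rewrite exprn_even_gt0.
Qed.

Lemma mode_gain_ge0 tau x om : 0 <= tau -> 0 <= x -> tau * x < pi / 2 ->
  0 <= mode_gain tau x om.
Proof.
move=> tau0 x0 txpi; have [->|xn0] := eqVneq x 0.
  by rewrite /mode_gain expr0n mul0r.
by rewrite mode_gainE// invr_ge0 ltW// delayD_gt0// mulr_ge0.
Qed.

(** Substituting y = om / x reduces the claim to the normalised delay [tau * x]; the mode [x = 0]
    contributes nothing. *)
Lemma integral_mode_gain (tau x : R) : 0 <= tau -> 0 <= x -> tau * x < pi / 2 ->
  (\int[mu]_om (mode_gain tau x om)%:E = (2 * pi * perf tau x)%:E)%E.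
Proof.
move=> tau0 x0 txpi; have [->|xn0] := eqVneq x 0.
  rewrite /perf !mul0r mulr0 integral0_eq// => om _.
  by rewrite /mode_gain expr0n/= mul0r.
have xp : 0 < x by rewrite lt_def xn0.
have tx0 : 0 <= tau * x by exact: mulr_ge0.
pose G y := (delayD (tau * x) y)^-1; pose F (om : R) := x^-1 * om.
have dF (y : R) : is_derive y 1 F (x^-1).
  by have := is_deriveZ x^-1 (is_derive_id y 1); rewrite /GRing.scale/= mulr1.
have F' : F^`() = cst x^-1.
  by apply/funext => y; rewrite derive1E; have [_ ->] := dF y.
have := delay_integral tx0 txpi.
rewrite (@increasing_ge0_integration_by_substitutionT R F G); last 9 first.
- by move=> y z yz; rewrite /F ltr_pM2l// invr_gt0.
- by rewrite F'; exact: cst_continuous.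
- by rewrite F'; exact: is_cvg_cst.
- by rewrite F'; exact: is_cvg_cst.
- by move=> y; have [] := dF y.
- by apply: gt0_cvgMrNy; [rewrite invr_gt0|exact: cvg_id].
- by apply: gt0_cvgMry; [rewrite invr_gt0|exact: cvg_id].
- exact: continuous_delayDV.
- by move=> y; rewrite invr_ge0 ltW// delayD_gt0.
rewrite F'.
have -> : (\int[mu]_om (((G \o F) * cst x^-1)%R om)%:E =
    (x^-1)%:E * \int[mu]_om (mode_gain tau x om)%:E)%E.
  rewrite -ge0_integralZl_EFin//.
  - by apply: eq_integral => om _; rewrite -EFinM /G /F /= mode_gainE// mulrC.
  - by move=> om _; rewrite lee_fin mode_gain_ge0.
  - apply/measurable_EFinP; apply: continuous_measurable_fun.
    exact: continuous_mode_gain.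
  - by rewrite invr_ge0.
move=> h; have := congr1 (fun z => x%:E * z)%E h.
rewrite muleA -EFinM mulfV// mul1e => ->; rewrite -EFinM; congr (_%:E).
have s1 : 1 - sin (tau * x) != 0.
  rewrite subr_eq0 eq_sym lt_eqF//; exact: sin_lt1.
by rewrite /perf; field.
Qed.

(** * Derivatives and Taylor bound of the scalar performance *)

Lemma is_derive_scale (k x : R) (f : R -> R) d : is_derive (k * x) 1 f d ->
  is_derive x 1 (fun t => f (k * t)) (d * k).
Proof.
move=> df; apply: (@is_derive1_comp R f (fun t => k * t)) => //.
by have := is_deriveZ k (is_derive_id x 1); rewrite /GRing.scale/= mulr1.
Qed.

Lemma is_derive_perf (tau x : R) : sin (tau * x) < 1 ->
  is_derive x 1 (perf tau) (dperf tau x).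
Proof.
move=> s1; have s0 : 2 * (1 - sin (tau * x)) != 0.
  by rewrite mulf_neq0// subr_eq0 eq_sym lt_eqF.
have dc := is_derive_scale (is_derive_cos (tau * x)).
have ds := is_derive_scale (is_derive_sin (tau * x)).
have dd := is_deriveZ 2 (is_deriveB (is_derive_cst (1 : R) x 1) ds).
have dv := @is_deriveV R (fun t => 2 * (1 - sin (tau * t))) x _ 1 s0 dd.
apply: (@is_derive_eq _ _ _ _ _ _ _ _
  (is_deriveM (is_deriveM (is_derive_id x 1) dc) dv)).
rewrite /GRing.scale /dperf /=; have := cos2sin2 (tau * x).
move: s0; set s := sin _; set c := cos _ => s0 c2.
have s1' : 1 - s != 0 by rewrite subr_eq0 eq_sym lt_eqF.
(* Once [c ^+ 2] is replaced by [1 - s ^+ 2], one factor [1 - s] cancels. *)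
have -> : x * c * (- (2 * (1 - s)) ^- 2 * (2 * (0 - c * tau))) =
  x * tau * c ^+ 2 / (2 * (1 - s) ^+ 2) by field.
by rewrite c2; field.
Qed.

Lemma is_derive_dperf (tau x : R) : sin (tau * x) < 1 ->
  is_derive x 1 (dperf tau)
    (tau * ((1 - sin (tau * x)) ^+ 2 + (cos (tau * x) + tau * x) * cos (tau * x))
      / (2 * (1 - sin (tau * x)) ^+ 2)).
Proof.
move=> s1; have s0 : 2 * (1 - sin (tau * x)) != 0.
  by rewrite mulf_neq0// subr_eq0 eq_sym lt_eqF.
have dc := is_derive_scale (is_derive_cos (tau * x)).
have ds := is_derive_scale (is_derive_sin (tau * x)).
have dd := is_deriveZ 2 (is_deriveB (is_derive_cst (1 : R) x 1) ds).
have dv := @is_deriveV R (fun t => 2 * (1 - sin (tau * t))) x _ 1 s0 dd.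
apply: (@is_derive_eq _ _ _ _ _ _ _ _
  (is_deriveM (is_deriveD dc (is_deriveZ tau (is_derive_id x 1))) dv)).
rewrite /GRing.scale /=; move: s0; set s := sin _; set c := cos _ => s0.
have s1' : 1 - s != 0 by rewrite subr_eq0 eq_sym lt_eqF.
rewrite [X in X * _](_ : _ = c + tau * x)//.
by field.
Qed.

(** On the interval, [sin (tau * x)] stays below [sin (tau * b) < 1], so the second derivative is
    bounded; two uses of the mean value inequality give the remainder. *)
Lemma perf_taylor (tau b : R) : 0 <= tau -> 0 <= b -> tau * b < pi / 2 ->
  exists C, forall x y, 0 <= x <= b -> 0 <= y <= b ->
    `|perf tau y - perf tau x - (y - x) * dperf tau x| <= C * (y - x) ^+ 2.
Proof.
move=> tau0 b0 tbpi; have tb0 : 0 <= tau * b by exact: mulr_ge0.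
pose m := 1 - sin (tau * b).
have m0 : 0 < m by rewrite subr_gt0 sin_lt1.
have sm x : 0 <= x <= b -> sin (tau * x) <= 1 - m.
  move=> /andP[x0 xb]; rewrite /m subKr leNgt ltr_sin ?in_itv/= -?leNgt.
  - by rewrite ler_wpM2l.
  - by rewrite (ltW tbpi) andbT (le_trans _ tb0)// oppr_le0 divr_ge0// pi_ge0.
  - have -> /= : - (pi / 2) <= tau * x.
      by rewrite (le_trans _ (mulr_ge0 tau0 x0))// oppr_le0 divr_ge0// pi_ge0.
    by rewrite (le_trans _ (ltW tbpi))// ler_wpM2l.
have s1 x : 0 <= x <= b -> sin (tau * x) < 1.
  by move=> /sm; move: m0; lra.
(* The 4 bounds [(1 - sin) ^+ 2], the term [1 + tau * b] bounds the cosine product, and [m] bounds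
   [1 - sin] from below. *)
pose C := tau * (4 + (1 + tau * b)) / (2 * m ^+ 2).
have dC x : 0 <= x <= b ->
   `|tau * ((1 - sin (tau * x)) ^+ 2 + (cos (tau * x) + tau * x) * cos (tau * x))
      / (2 * (1 - sin (tau * x)) ^+ 2)| <= C.
  move=> xb; have sx := sm _ xb; have /andP[x0 xb'] := xb.
  have sx0 : 0 < 1 - sin (tau * x) by move: sx m0; lra.
  have d0 : 0 < 2 * (1 - sin (tau * x)) ^+ 2 by rewrite mulr_gt0// exprn_gt0.
  rewrite normrM [X in X * _]normrM (ger0_norm tau0) normfV (gtr0_norm d0).
  apply: ler_pM; rewrite ?mulr_ge0 ?invr_ge0 ?(ltW d0)//.
    apply: ler_wpM2l => //; rewrite (le_trans (ler_normD _ _))// lerD//.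
      rewrite ger0_norm ?sqr_ge0//; have := sin_geN1 (tau * x); have := sin_le1 (tau * x).
      by nra.
    rewrite normrM -[leRHS]mulr1 ler_pM ?cos_max//.
    rewrite (le_trans (ler_normD _ _))// lerD ?cos_max//.
    by rewrite ger0_norm ?mulr_ge0// ler_wpM2l.
  rewrite lef_pV2 ?posrE ?mulr_gt0 ?exprn_gt0// ler_wpM2l//.
  by rewrite lerXn2r// ?nnegrE; move: sx m0; lra.
exists C => x y xb yb.
have dlip t : 0 <= t <= b -> `|dperf tau t - dperf tau x| <= C * `|t - x|.
  move=> tb; apply: (lipschitz_of_derive _ dC xb tb) => u ub.
  exact/is_derive_dperf/s1.
have C0 : 0 <= C.
  apply: le_trans (dC _ xb); exact: normr_ge0.
pose h t := perf tau t - t * dperf tau x.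
have xyb t : Num.min x y <= t <= Num.max x y -> 0 <= t <= b.
  move: xb yb => /andP[x0 xb] /andP[y0 yb].
  rewrite ge_min le_max => /andP[h1 h2]; apply/andP; split.
    by case/orP : h1; exact: le_trans.
  by case/orP : h2 => /le_trans; apply.
have := @lipschitz_of_derive _ h (fun t => dperf tau t - dperf tau x)
  (Num.min x y) (Num.max x y) (C * `|y - x|) x y.
rewrite /h (_ : _ - _ - _ = perf tau y - perf tau x - (y - x) * dperf tau x); last by ring.
rewrite -mulrA -expr2 real_normK ?num_real//; apply.
- move=> t /xyb tb; apply: is_deriveB; first exact/is_derive_perf/s1.
  have := is_deriveM (is_derive_id t 1) (is_derive_cst (dperf tau x) t 1).
  by rewrite /GRing.scale/= mulr0 add0r mulr1.
- move=> t txy; rewrite (le_trans (dlip _ (xyb _ txy)))// ler_wpM2l//.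
  move: txy; have [xy|/ltW yx] := leP x y => /andP[h1 h2].
    by rewrite !ger0_norm ?subr_ge0// lerD2r.
  by rewrite !ler0_norm ?subr_le0// lerN2 lerD2r.
- by rewrite ge_min lexx le_max lexx.
- by rewrite ge_min lexx orbT le_max lexx orbT.
Qed.

Lemma is_derive_of_quadratic_error (f : R -> R) x d (C r : R) : 0 < r ->
  (forall t, `|t - x| < r -> `|f t - f x - (t - x) * d| <= C * (t - x) ^+ 2) ->
  is_derive x 1 f d.
Proof.
move=> r0 fC.
suff h : (fun h => h^-1 *: (f (h *: 1 + x) - f x)) @ 0^' --> d.
  by apply: DeriveDef; [apply/cvg_ex; exists d|exact: cvg_lim].
apply/cvgrPdist_le => e e0; near=> h.
have h0 : h != 0 by near: h; exact: nbhs_dnbhs_neq.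
have hr : `|h| < r by near: h; apply: dnbhs0_lt.
have he : `|h| <= e / (`|C| + 1).
  by near: h; apply: dnbhs0_le; rewrite divr_gt0// ltr_wpDl.
have := fC (h + x); rewrite addrK => /(_ hr).
rewrite /GRing.scale /= mulr1 => hC.
have -> : d - h^-1 * (f (h + x) - f x) = - h^-1 * (f (h + x) - f x - h * d) by field.
rewrite normrM normrN normfV mulrC ler_pdivrMr ?normr_gt0//.
rewrite (le_trans hC)// -[h ^+ 2]real_normK ?num_real// expr2 mulrA.
rewrite ler_wpM2r// (le_trans (ler_wpM2r _ (ler_norm C)))//.
move: he; rewrite ler_pdivlMr ?ltr_wpDl// => he.
by rewrite (le_trans _ he)// mulrC ler_wpM2l// lerDl.
Unshelve. all: by end_near. Qed.

End performance.

(** * From the transfer function to a sum over eigenvalues *)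

Section sensor_noise_performance.
Variables (R : realType) (n : nat).
Notation mu := (@lebesgue_measure R).
Notation Re := complex.Re.
Notation Im := complex.Im.
Implicit Types (Q P : 'M[R]_n) (d : 'I_n -> R).

Lemma mxC_fmx Q d : mxC (fmx Q d) = fmx (mxC Q) (fun l => ((d l)%:C)%C).
Proof.
apply/matrixP => i j; rewrite mxE !fmxE rmorph_sum; apply: eq_bigr => l _.
by rewrite !rmorphM/= !mxE.
Qed.

Lemma mxC_orthogonal Q : Q *m Q^T = 1%:M -> mxC Q *m (mxC Q)^T = 1%:M.
Proof.
move=> QQ; have -> : mxC Q = map_mx (real_complex R) Q by [].
by rewrite map_trmx -map_mxM QQ map_mx1.
Qed.

Lemma mx_adj_fmx Q (y : 'I_n -> R[i]) :
  mx_adj (fmx (mxC Q) y) = fmx (mxC Q) (fun l => conjc (y l)).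
Proof.
rewrite /mx_adj trmx_fmx; apply/matrixP => i j; rewrite [LHS]mxE 2!fmxE rmorph_sum.
by apply: eq_bigr => l _; rewrite !rmorphM/= !mxE !conjc_real.
Qed.

(** All factors are diagonal in the basis [Q], so the trace adds the squared moduli of the modal
    gains; positive denominators make the inverse genuine. *)
Lemma h2_integrand_fmx Q d tau om : Q *m Q^T = 1%:M ->
  Mn R n *m fmx Q d = fmx Q d ->
  (forall l, 0 < d l ^+ 2 + om ^+ 2 - 2 * d l * om * sin (tau * om)) ->
  h2_integrand (fmx Q d) tau om = \sum_l mode_gain tau (d l) om.
Proof.
move=> QQ MQ D0; have QC := mxC_orthogonal QQ.
pose dC l := ((d l)%:C)%C.
pose e := (cos (tau * om) -i* sin (tau * om))%C.
pose x l := (0 +i* om)%C * 1 + e * dC l.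
have Rex l : Re (x l) = cos (tau * om) * d l by rewrite /x /e /dC /=; ring.
have Imx l : Im (x l) = om - sin (tau * om) * d l by rewrite /x /e /dC /=; ring.
have nx l : Re (x l) ^+ 2 + Im (x l) ^+ 2 =
    d l ^+ 2 + om ^+ 2 - 2 * d l * om * sin (tau * om).
  by rewrite Rex Imx exprMn cos2sin2; ring.
have x0 l : x l != 0.
  apply/eqP => xl0; have := D0 l; rewrite -nx xl0 /= expr0n addr0 ltxx//.
have GE : Gjw (fmx Q d) tau om = fmx (mxC Q) (fun l => dC l * (x l)^-1).
  rewrite /Gjw mxC_fmx -/e -/dC.
  have -> : (0 +i* om)%C%:M + e *: fmx (mxC Q) dC = fmx (mxC Q) x.
    by rewrite /x fmxD !fmxZ fmx1// scalemx1.
  have ML : mxC (Mn R n) *m fmx (mxC Q) dC = fmx (mxC Q) dC.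
    rewrite -mxC_fmx -[in RHS]MQ; exact/esym/(@map_mxM _ _ (real_complex R)).
  (* The resolvent commutes with the Laplacian, which brings the latter next to the centering matrix
     that fixes it. *)
  rewrite (invmx_fmx QC x0) -mulmxA (fmxM _ _ QC).
  rewrite (_ : (fun l => _) = fun l => dC l * (x l)^-1); last first.
    by apply/funext => l; rewrite mulrC.
  by rewrite -(fmxM dC _ QC) mulmxA ML.
rewrite /h2_integrand GE mx_adj_fmx (fmxM _ _ QC) (mxtrace_fmx _ QC).
rewrite (big_morph _ (@ReD R) (erefl _)); apply: eq_bigr => l _.
have n0 : Re (x l) ^+ 2 + Im (x l) ^+ 2 != 0 by rewrite nx gt_eqF.
rewrite ReJM !(ReM, ImM) ReV ImV /mode_gain -nx.
have [-> ->] : Re (dC l) = d l /\ Im (dC l) = 0 by [].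
by move: n0; move: (Re (x l)) (Im (x l)) => u v n0; field.
Qed.

Lemma rho_ss_fmx Q d tau : Q *m Q^T = 1%:M ->
  Mn R n *m fmx Q d = fmx Q d -> 0 <= tau ->
  (forall l, 0 <= d l) -> (forall l, tau * d l < pi / 2) ->
  rho_ss (fmx Q d) tau = \sum_l perf tau (d l).
Proof.
move=> QQ MQ tau0 d0 dpi.
have mg l : measurable_fun [set: R] (fun om => (mode_gain tau (d l) om)%:E).
  apply/measurable_EFinP; apply: continuous_measurable_fun.
  exact: continuous_mode_gain.
have hE om : ([set: R] `\ 0) om -> (h2_integrand (fmx Q d) tau om)%:E =
    (\sum_l (mode_gain tau (d l) om)%:E)%E.
  move=> [_ /eqP om0]; rewrite sumEFin h2_integrand_fmx// => l.
  exact: mode_denom_gt0.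
have mD : measurable ([set: R] `\ 0) by apply: measurableD => //; exact: measurable_set1.
have mS : measurable_fun [set: R] (fun om => \sum_l (mode_gain tau (d l) om)%:E)%E.
  exact: emeasurable_sum.
have -> : rho_ss (fmx Q d) tau = fine
    (\int[mu]_om (\sum_l (mode_gain tau (d l) om)%:E)%E) / (2 * pi).
  (* The frequency 0, at which a zero eigenvalue makes the inverted matrix singular, is discarded as
     a null set. *)
  rewrite /rho_ss -(@integral_setD1 _ _ 0)//; last first.
    apply: (eq_measurable_fun (fun om => \sum_l (mode_gain tau (d l) om)%:E)%E).
      by move=> om /[!inE] /hE ->.
    exact: measurable_funS mS.
  rewrite -[in RHS](@integral_setD1 _ _ 0)//; last exact: measurable_funS mS.
  by congr (fine _ / _); apply: eq_integral => om /[!inE]; exact: hE.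
rewrite ge0_integral_sum//; last by move=> l om _; rewrite lee_fin mode_gain_ge0.
under eq_bigr do rewrite integral_mode_gain//.
by rewrite sumEFin/= -mulr_sumr mulrC mulKf// mulf_neq0// gt_eqF// pi_gt0.
Qed.

(** * Pseudo-inverse, averaging projection and Laplacian *)

Lemma penrose_unique (A X Y : 'M[R]_n) : penrose A X -> penrose A Y -> X = Y.
Proof.
move=> [AXA XAX AXT XAT] [AYA YAY AYT YAT].
have AXY : A *m X = A *m Y.
  have h : A *m X = A *m Y *m (A *m X) by rewrite mulmxA AYA.
  by rewrite -AXT {1}h trmx_mul AXT AYT mulmxA AXA.
have XYA : X *m A = Y *m A.
  have h : X *m A = X *m A *m (Y *m A) by rewrite -mulmxA (mulmxA A) AYA.
  by rewrite -XAT {1}h trmx_mul XAT YAT -mulmxA (mulmxA A X) AXA.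
by rewrite -XAX -mulmxA AXY mulmxA XYA YAY.
Qed.

(** For [n > 0], the orthogonal projection onto the constant vectors, complementary to [Mn]. *)
Definition mean_mx : 'M[R]_n := (n%:R)^-1 *: const_mx 1.
Local Notation J := mean_mx.

Lemma mean_mx_Evec e : J *m Evec R e = 0.
Proof.
rewrite -scalemxAl (_ : const_mx 1 *m _ = 0) ?scaler0//.
apply/matrixP => i j; rewrite !mxE.
have S (a : 'I_n) : \sum_k (k == a)%:R = 1 :> R.
  by rewrite (bigD1 a)//= eqxx big1 ?addr0// => k /negPf ->.
under eq_bigr do rewrite !mxE mul1r.
by rewrite sumrB !S subrr.
Qed.

Lemma trmx_mean_mx : J^T = J.
Proof. by rewrite linearZ/= trmx_const. Qed.

Lemma mean_mx_lap E w : J *m lap E w = 0.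
Proof.
rewrite mulmx_sumr big1// => e _.
by rewrite -scalemxAr mulmxA mean_mx_Evec mul0mx scaler0.
Qed.

Lemma trmx_lap E (w : 'I_n * 'I_n -> R) : (lap E w)^T = lap E w.
Proof.
rewrite linear_sum/=; apply: eq_bigr => e _.
by rewrite linearZ/= trmx_mul trmxK.
Qed.

Lemma Mn_lap E w : Mn R n *m lap E w = lap E w.
Proof. by rewrite mulmxBl mul1mx mean_mx_lap subr0. Qed.

Lemma lap_upd (E : {set 'I_n * 'I_n}) (w : 'I_n * 'I_n -> R) e t : e \in E ->
  lap E (upd w e t) = lap E w + (t - w e) *: (Evec R e *m (Evec R e)^T).
Proof.
move=> eE; rewrite /lap !(bigD1 e eE)/= {1}/upd eqxx.
rewrite addrAC -scalerDl subrKC; congr (_ + _).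
by apply: eq_bigr => e' /andP[_ /negPf e'e]; rewrite /upd e'e.
Qed.

Lemma mul_mean_mx : (0 < n)%N -> J *m J = J.
Proof.
move=> n0; apply/matrixP => i j; rewrite !mxE.
under eq_bigr do rewrite !mxE !mulr1.
by rewrite sumr_const card_ord -[LHS]mulr_natr; field; rewrite pnatr_eq0 -lt0n.
Qed.

(** The sine term vanishes on constants, where [K] and its inverse [V] therefore act as the
    identity. Subtracting [J] from both leaves mutual inverses off the constants, with both products
    equal to [1%:M - J]. *)
Lemma mp_pinv_delay Q d tau : (0 < n)%N -> Q *m Q^T = 1%:M ->
  J *m fmx Q d = 0 -> (forall l, sin (tau * d l) < 1) ->
  mp_pinv (Mn R n - fmx Q (fun l => sin (tau * d l))) =
  fmx Q (fun l => (1 - sin (tau * d l))^-1) - J.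
Proof.
move=> n0 QQ Jd s1; have JJ := mul_mean_mx n0.
pose S := fmx Q (fun l => sin (tau * d l)).
pose K := fmx Q (fun l => 1 - sin (tau * d l)).
pose V := fmx Q (fun l => (1 - sin (tau * d l))^-1).
have s0 l : 1 - sin (tau * d l) != 0 by rewrite subr_eq0 eq_sym lt_eqF.
have JS : J *m S = 0.
  (* Factoring out [d] is harmless at a zero eigenvalue because [sin 0 = 0]. *)
  have -> : S = fmx Q d *m fmx Q (fun l => (d l)^-1 * sin (tau * d l)).
    rewrite fmxM//; congr fmx; apply/funext => l.
    have [->|dl] := eqVneq (d l) 0; first by rewrite mulr0 sin0 mul0r.
    by rewrite mulVKf.
  by rewrite mulmxA Jd mul0mx.
have SJ : S *m J = 0 by rewrite -[LHS]trmxK trmx_mul trmx_mean_mx trmx_fmx JS trmx0.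
have KE : K = 1%:M - S.
  rewrite -(fmx1 QQ) -scaleN1r -fmxZ -fmxD; congr fmx.
  by apply/funext => l; rewrite mulN1r.
have KV : K *m V = 1%:M.
  by rewrite fmxM// -(fmx1 QQ); congr fmx; apply/funext => l; rewrite mulfV.
have VK : V *m K = 1%:M by exact: mulmx1C.
have JK : J *m K = J by rewrite KE mulmxBr mulmx1 JS subr0.
have KJ : K *m J = J by rewrite KE mulmxBl mul1mx SJ subr0.
have JV : J *m V = J by rewrite -{1}JK -mulmxA KV mulmx1.
have VJ : V *m J = J by rewrite -{1}KJ mulmxA VK mul1mx.
have AE : Mn R n - S = K - J by rewrite KE /Mn -/J addrAC.
have AX : (K - J) *m (V - J) = 1%:M - J.
  by rewrite mulmxBr !mulmxBl KV JV KJ JJ subrr subr0.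
have XA : (V - J) *m (K - J) = 1%:M - J.
  by rewrite mulmxBr !mulmxBl VK JK VJ JJ subrr subr0.
rewrite -/S AE; suff PX : penrose (K - J) (V - J).
  (* Uniqueness determines the matrix picked by the choice operator in [mp_pinv]. *)
  by apply: xget_unique => // Y PY; exact: penrose_unique PY PX.
split; rewrite ?AX ?XA.
- by rewrite mulmxBl mul1mx mulmxBr JK JJ subrr subr0.
- by rewrite mulmxBl mul1mx mulmxBr JV JJ subrr subr0.
- by rewrite linearB/= trmx1 trmx_mean_mx.
- by rewrite linearB/= trmx1 trmx_mean_mx.
Qed.

(** * Eigenvalue bounds through diagonal coefficients *)

Lemma eigenvalue_fmx Q d l : Q *m Q^T = 1%:M -> eigenvalue (fmx Q d) (d l).
Proof.
move=> QQ; apply/eigenvalueP; exists (row l Q).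
  rewrite -row_mul /fmx !mulmxA QQ mul1mx.
  by rewrite mul_diag_mx; apply/rowP => j; rewrite !mxE.
apply/negP => /eqP r0; have := congr1 (row l) QQ; rewrite row_mul r0 mul0mx.
by move=> /rowP/(_ l); rewrite !mxE eqxx => /esym/eqP; rewrite oner_eq0.
Qed.

(** An eigenvalue is the quadratic form at its unit eigenvector, so bounds on quadratic forms pass
    to eigenvalues. *)
Lemma fmx_diag_coef P d m : P *m P^T = 1%:M ->
  (P *m fmx P d *m P^T) m m = d m.
Proof.
move=> PP; rewrite /fmx !mulmxA PP mul1mx -mulmxA PP mulmx1.
by rewrite !mxE eqxx.
Qed.

Lemma rank1_diag_coef P (v : 'cV[R]_n) m :
  (P *m (v *m v^T) *m P^T) m m = (P *m v) m 0 ^+ 2.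
Proof.
have -> : P *m (v *m v^T) *m P^T = (P *m v) *m (P *m v)^T.
  by rewrite trmx_mul !mulmxA.
by rewrite [LHS]mxE big_ord1 [X in _ * X]mxE expr2.
Qed.

Lemma lap_diag_coef_ge0 (E : {set 'I_n * 'I_n}) (w : 'I_n * 'I_n -> R) P m : (forall e, e \in E -> 0 <= w e) ->
  0 <= (P *m lap E w *m P^T) m m.
Proof.
move=> w0; rewrite mulmx_sumr mulmx_suml summxE sumr_ge0// => e eE.
rewrite -scalemxAr -scalemxAl mxE rank1_diag_coef.
by rewrite mulr_ge0 ?sqr_ge0 ?w0.
Qed.

(** The entries of a unit row have modulus at most 1, so a difference of two has modulus at most
    2. *)
Lemma orthogonal_Evec_le P e m : P *m P^T = 1%:M ->
  (P *m Evec R e) m 0 ^+ 2 <= 4.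
Proof.
move=> PP; have P1 i : P m i ^+ 2 <= 1.
  have := congr1 (fun A : 'M[R]_n => A m m) PP; rewrite !mxE eqxx mulr1n => <-.
  rewrite (bigD1 i)//= mxE -expr2 lerDl sumr_ge0// => k _.
  by rewrite mxE -expr2 sqr_ge0.
have -> : (P *m Evec R e) m 0 = P m e.1 - P m e.2.
  have S (a : 'I_n) : \sum_k P m k * (k == a)%:R = P m a.
    rewrite (bigD1 a)//= eqxx mulr1 big1 ?addr0// => k /negPf ->.
    by rewrite mulr0.
  rewrite mxE; under eq_bigr do rewrite mxE mulrBr.
  by rewrite sumrB !S.
have := P1 e.1; have := P1 e.2; have := sqr_ge0 (P m e.1 + P m e.2).
by rewrite !expr2; lra.
Qed.

(** The coefficient is an average of the [d l] with weights [T m l ^+ 2] of sum one. *)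
Lemma fmx_diag_coef_le Q P d lam m : Q *m Q^T = 1%:M -> P *m P^T = 1%:M ->
  (forall l, d l <= lam) -> (P *m fmx Q d *m P^T) m m <= lam.
Proof.
move=> QQ PP dlam; pose T := P *m Q^T.
have E x : (P *m fmx Q x *m P^T) m m = \sum_l x l * T m l ^+ 2.
  have -> : P *m fmx Q x *m P^T = T *m diag_mx (\row_l x l) *m T^T.
    by rewrite /fmx /T trmx_mul trmxK !mulmxA.
  rewrite [LHS]mxE; apply: eq_bigr => l _.
  by rewrite mul_mx_diag !mxE; ring.
have T1 : \sum_l T m l ^+ 2 = 1.
  have := E (fun=> 1); rewrite fmx1// mulmx1 PP mxE eqxx mulr1n => ->.
  by apply: eq_bigr => l _; rewrite mul1r.
rewrite E -[leRHS]mulr1 -T1 mulr_sumr; apply: ler_sum => l _.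
by rewrite ler_wpM2r ?sqr_ge0.
Qed.

End sensor_noise_performance.

(** * Derivative of the performance with respect to one link weight *)

Theorem theorem6 (R : realType) (n : nat) (E : {set 'I_n * 'I_n})
  (w : 'I_n * 'I_n -> R) (tau : R) :
  (forall e, e \in E -> (e.1 < e.2)%N) ->
  (forall e, e \in E -> 0 < w e) ->
  connected_graph E ->
  0 <= tau ->
  (exists lam, largest_eig (lap E w) lam /\ tau * lam < pi / 2) ->
  forall e, e \in E ->
    is_derive (w e) 1 (fun t : R => rho_ss (lap E (upd w e t)) tau)
      (2^-1 * ((Evec R e)^T *m (tau *: lap E w + mx_cos (tau *: lap E w))
                 *m mp_pinv (Mn R n - mx_sin (tau *: lap E w)) *m Evec R e) 0 0).
Proof.
move=> _ w0 _ tau0 [lam [[_ lam_max] taulam]] e eE.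
have n0 : (0 < n)%N by case: n e {E w w0 lam_max eE} => [[[]]|].
set v := Evec R e; pose B := v *m v^T.
have trB X : \tr (X *m B) = (v^T *m (X *m v)) 0 0.
  by rewrite /B mulmxA mxtrace_mulC /mxtrace big_ord1.
(* The averaging part of the pseudo-inverse annihilates the edge vector. *)
have mulB (X Y : 'M[R]_n) :
    v^T *m X *m (Y - mean_mx R n) *m v = v^T *m (X *m Y *m v).
  by rewrite -[LHS]mulmxA mulmxBl mean_mx_Evec subr0 !mulmxA.
have [Q [d' [QQ LQ]]] := sym_orthogonal_diag (trmx_lap E w).
pose a l := d' 0 l.
have LE : lap E w = fmx Q a.
  by rewrite LQ /fmx; congr (_ *m diag_mx _ *m _); apply/rowP => l; rewrite mxE.
have a0 l : 0 <= a l.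
  rewrite -(fmx_diag_coef a l QQ) -LE; apply: lap_diag_coef_ge0 => e' e'E.
  exact/ltW/w0.
have alam l : a l <= lam by apply: lam_max; rewrite LE; exact: eigenvalue_fmx.
have lam0 : 0 <= lam by exact: le_trans (a0 (Ordinal n0)) (alam _).
(* A weight change below [r] moves eigenvalue bounds by at most [4 * r]; this [r] uses at most half
   of the stability margin, also when [tau = 0]. *)
have [r r0 rlam] : exists2 r, 0 < r & tau * (lam + 4 * r) < pi / 2.
  exists ((pi / 2 - tau * lam) / (8 * (tau + 1))).
    by rewrite divr_gt0 ?subr_gt0// mulr_gt0// ltr_wpDl.
  set g := pi / 2 - tau * lam; have g0 : 0 < g by rewrite subr_gt0.
  have -> : tau * (lam + 4 * (g / (8 * (tau + 1)))) =
      tau * lam + g * (tau / (tau + 1)) / 2.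
    by field; rewrite gt_eqF// ltr_wpDl.
  have : g * (tau / (tau + 1)) <= g.
    by rewrite ler_piMr ?(ltW g0)// ler_pdivrMr ?ltr_wpDl// mul1r lerDl.
  by move: g0; rewrite /g; lra.
pose b := lam + 4 * r.
have b0 : 0 <= b by rewrite /b addr_ge0// mulr_ge0// ltW.
have ab l : 0 <= a l <= b.
  by rewrite a0/= (le_trans (alam l))// lerDl mulr_ge0// ltW.
have tab x : 0 <= x <= b -> tau * x < pi / 2.
  by move=> /andP[_ xb]; rewrite (le_lt_trans _ rlam)// ler_wpM2l.
have [C hC] := perf_taylor tau0 b0 rlam.
have s1 l : sin (tau * a l) < 1 by rewrite sin_lt1 ?mulr_ge0 ?tab.
have -> : 2^-1 * (v^T *m (tau *: lap E w + mx_cos (tau *: lap E w))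
    *m mp_pinv (Mn R n - mx_sin (tau *: lap E w)) *m v) 0 0 =
    \tr (fmx Q (dperf tau \o a) *m B).
  rewrite LE -fmxZ mx_cos_fmx// mx_sin_fmx// -fmxD mp_pinv_delay//; last first.
    by rewrite -LE; exact: mean_mx_lap.
  rewrite trB mulB fmxM//.
  set X := (X in _ * (_ *m (X *m _)) _ _); set Y := fmx _ (_ \o _).
  have -> : Y = 2^-1 *: X.
    rewrite /X -fmxZ; congr fmx; apply/funext => l; rewrite /= /dperf.
    by have := s1 l => ?; field; rewrite subr_eq0 gt_eqF.
  by rewrite -scalemxAl -scalemxAr [RHS]mxE.
(* Radius [r] keeps the eigenvalues below [b]; radius [w e] keeps the modified weight positive. *)
apply: (@is_derive_of_quadratic_error _ _ _ _ (C * \tr (B *m B)) (Num.min r (w e))).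
  by rewrite lt_min r0 w0.
move=> t; rewrite lt_min => /andP[tr tw].
have t0 : 0 < t.
  by move: tw; rewrite ltr_norml => /andP[+ _]; rewrite ltrBrDr addNr.
(* The perturbed Laplacian gets its own eigenbasis, with no relation to [Q]; [trace_taylor] compares
   the two. *)
have [P [c' [PP LP]]] := sym_orthogonal_diag (trmx_lap E (upd w e t)).
pose c l := c' 0 l.
have LtE : lap E (upd w e t) = fmx P c.
  by rewrite LP /fmx; congr (_ *m diag_mx _ *m _); apply/rowP => l; rewrite mxE.
have dL : fmx P c - fmx Q a = (t - w e) *: B.
  by rewrite -LtE -LE lap_upd// addrC addKr.
have cb m : 0 <= c m <= b.
  apply/andP; split.
    rewrite -(fmx_diag_coef c m PP) -LtE; apply: lap_diag_coef_ge0 => e' e'E.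
    by rewrite /upd; case: eqP => _; [exact: ltW|exact/ltW/w0].
  (* The upper bound splits the quadratic form into that of the original Laplacian and the rank-one
     change. *)
  rewrite -(fmx_diag_coef c m PP) -LtE lap_upd// LE mulmxDr mulmxDl mxE.
  rewrite lerD ?fmx_diag_coef_le// -scalemxAr -scalemxAl mxE rank1_diag_coef.
  rewrite mulrC (le_trans (ler_wpM2l (sqr_ge0 _) (ler_norm _)))//.
  by rewrite ler_pM ?sqr_ge0 ?orthogonal_Evec_le// ltW.
have updE : lap E (upd w e (w e)) = fmx Q a.
  by rewrite lap_upd// subrr scale0r addr0.
have ML : Mn R n *m fmx Q a = fmx Q a by rewrite -LE Mn_lap.
have MLt : Mn R n *m fmx P c = fmx P c by rewrite -LtE Mn_lap.
rewrite updE LtE.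
rewrite (rho_ss_fmx PP MLt tau0) => [||l]; last exact: tab (cb l).
  rewrite (rho_ss_fmx QQ ML tau0 a0) => [|l]; last exact: tab (ab l).
  have := @trace_taylor _ _ Q P a c (perf tau) (dperf tau) C QQ PP.
  have -> : C * \tr (B *m B) * (t - w e) ^+ 2 =
      C * \tr (((t - w e) *: B) *m ((t - w e) *: B)).
    by rewrite -scalemxAl -scalemxAr !mxtraceZ; ring.
  have -> : (t - w e) * \tr (fmx Q (dperf tau \o a) *m B) =
      \tr (fmx Q (dperf tau \o a) *m ((t - w e) *: B)).
    by rewrite -scalemxAr mxtraceZ.
  by rewrite dL; apply=> l m; exact: hC.
by move=> l; case/andP : (cb l).
Qed.
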